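(* Let $(E,[\![\cdot,\cdot]\!],\rho)$ be a Lie algebroid over a manifold $Q$, $H:E^*\times\mathbb{R}\to\mathbb{R}$ a Hamiltonian function, and $\mathcal{E}_{v_H}\in Sec(\mathcal{T}^E(E^*\times\mathbb{R}))$ the corresponding evolution section. Let $\gamma$ be a section of $\pi:E^*\times\mathbb{R}\to Q$ such that $j_\gamma:F_\gamma\to\mathcal{T}^E(E^*\times\mathbb{R})$, $i_\gamma:\gamma(Q)\to E^*\times\mathbb{R}$ is a Legendrian Lie subalgebroid of $\mathcal{T}^E(E^*\times\mathbb{R})$, and put $\mathcal{E}_{v_H}^\gamma=pr_1\circ\mathcal{E}_{v_H}\circ\gamma\in Sec(E)$. Then $\mathcal{E}_{v_H}$ and $\mathcal{E}_{v_H}^\gamma$ are $\gamma$-related, i.e. $$\mathcal{E}_{v_H}\circ\gamma=(\mathrm{Id}_E,T\gamma\circ\rho)\circ\mathcal{E}_{v_H}^\gamma,$$ if and only if $$\mathrm{d}^E(H\circ\gamma)=0 .$$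
   Context: All manifolds and maps are $C^\infty$; repeated indices are summed. Lie algebroids. A Lie algebroid $(E,[\![\cdot,\cdot]\!],\rho)$ over $Q$ is a vector bundle $\tau:E\to Q$ with a Lie bracket $[\![\cdot,\cdot]\!]$ on its sections $Sec(E)$ and a vector bundle map $\rho:E\to TQ$ (anchor) such that $[\![\sigma_1,f\sigma_2]\!]=f[\![\sigma_1,\sigma_2]\!]+(\rho(\sigma_1)f)\sigma_2$ for $f\in C^\infty(Q)$. In local coordinates $(q^i)$ on $Q$ and a local basis $\{e_\alpha\}$ of $Sec(E)$, the structure functions are defined by $\rho(e_\alpha)=\rho^i_\alpha\,\partial/\partial q^i$, $[\![e_\alpha,e_\beta]\!]=\mathcal{C}^\gamma_{\alpha\beta}e_\gamma$. The exterior differential $\mathrm{d}^E:Sec(\bigwedge^kE^* )\to Sec(\bigwedge^{k+1}E^* )$ is $\mathrm{d}^E\mu(\sigma_1,\dots,\sigma_{k+1})=\sum_i(-1)^{i+1}\rho(\sigma_i)\mu(\dots,\widehat{\sigma_i},\dots)+\sum_{i<j}(-1)^{i+j}\mu([\![\sigma_i,\sigma_j]\!],\dots,\widehat{\sigma_i},\dots,\widehat{\sigma_j},\dots)$; for a function $f$ on $Q$, $\mathrm{d}^Ef(\sigma)=\rho(\sigma)f$. A vector bundle morphism $(F,f)$ between Lie algebroids $E\to Q$ and $E'\to Q'$ is a Lie algebroid morphism if $\mathrm{d}^E((F,f)^*\sigma')=(F,f)^*(\mathrm{d}^{E'}\sigma')$ for all $\sigma'\in Sec(\bigwedge^k(E')^*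 )$ and all $k$, where $((F,f)^*\sigma')_q(a_1,\dots,a_k)=\sigma'_{f(q)}(F(a_1),\dots,F(a_k))$. A Lie subalgebroid of $E\to M$ is a Lie algebroid morphism $j:F\to E$, $i:N\to M$ such that $(j,i)$ is a monomorphism of vector bundles and $i$ is an injective immersion. Contact Lie algebroids. A Lie algebroid $A\to M$ of rank $2k+1$ is contact if it has a section $\eta$ of $A^*$ with $\eta\wedge(\mathrm{d}^A\eta)^k\neq0$ everywhere; its Reeb section is the unique section $\mathcal{R}$ of $A$ with $\imath_{\mathcal{R}}\mathrm{d}^A\eta=0$, $\imath_{\mathcal{R}}\eta=1$. A Lie subalgebroid $j:F\to A$, $i:N\to M$ is Legendrian if $\dim F_x=k$ and $\eta(i(x))|_{j(F_x)}=0$ for all $x\in N$. Prolongation. Let $\pi:E^*\times\mathbb{R}\to Q$, $\pi(b^*_q,s)=q$. $\mathcal{T}^E(E^*\times\mathbb{R})\to E^*\times\mathbb{R}$ is the vector bundle with fibre over $(b^*_q,s)$ equal to $\{(a_q,v)\in E_q\times T_{(b^*_q,s)}(E^*\times\mathbb{R}):\rho(a_q)=T\pi(v)\}$; $pr_1(a_q,v)=a_q$. With coordinates $(q^i,y_\alpha,s)$ on $E^*\times\mathbb{R}$ induced by $(q^i)$ and the dual basis of $\{e_\alpha\}$, a local basis of sections is $\widetilde{\mathcal{X}}_\alpha=(e_\alpha,\rho^i_\alpha\,\partial/\partial q^i)$, $\widetilde{\mathcal{V}}_\alpha=(0,\partial/\partial y_\alpha)$, $\widetilde{\mathcal{V}}_s=(0,\partial/\partial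 s)$, with dual basis $\widetilde{\mathcal{X}}^\alpha,\widetilde{\mathcal{V}}^\alpha,\widetilde{\mathcal{V}}^s$. It is a Lie algebroid with anchor $\rho^{*\pi}(a_q,v)=v$ and bracket determined by $[\![\widetilde{\mathcal{X}}_\alpha,\widetilde{\mathcal{X}}_\beta]\!]^{*\pi}=\mathcal{C}^\gamma_{\alpha\beta}\widetilde{\mathcal{X}}_\gamma$, all other brackets of basis sections being zero. Let $\mathrm{d}$ be its exterior differential. It is a contact Lie algebroid with contact section $\eta=\widetilde{\mathcal{V}}^s-\Theta$, where $\widetilde{\mathcal{V}}^s=\mathrm{d}s$ and $\Theta_{(b^*_q,s)}(a_q,v)=b^*_q(a_q)$ (locally $\eta=\widetilde{\mathcal{V}}^s-y_\alpha\widetilde{\mathcal{X}}^\alpha$); its Reeb section is $\mathcal{R}=\widetilde{\mathcal{V}}_s$. The Hamiltonian section $\xi_H$ of $H$ is the unique section of $\mathcal{T}^E(E^*\times\mathbb{R})$ with $\imath_{\xi_H}\eta=-H$, $\imath_{\xi_H}\mathrm{d}\eta=\mathrm{d}H-\rho^{*\pi}(\mathcal{R})(H)\eta$, and the evolution section is $\mathcal{E}_{v_H}=\xi_H+H\mathcal{R}$; locally $\mathcal{E}_{v_H}=\frac{\partial H}{\partial y_\alpha}\widetilde{\mathcal{X}}_\alpha-\big(\rho^i_\alpha\frac{\partial H}{\partial q^i}+\mathcal{C}^\gamma_{\alpha\beta}y_\gamma\frac{\partial H}{\partial y_\beta}+y_\alpha\frac{\partial H}{\partial s}\big)\widetilde{\mathcal{V}}_\alpha+y_\alpha\frac{\partial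 H}{\partial y_\alpha}\widetilde{\mathcal{V}}_s$. For a section $\gamma$ of $\pi$: $(\mathrm{Id}_E,T\gamma\circ\rho):E\to\mathcal{T}^E(E^*\times\mathbb{R})$ is the map $a\mapsto(a,T\gamma(\rho(a)))$. $F_\gamma=\{(a,T\gamma(\rho(a))):a\in E\}$ is a vector bundle over $\gamma(Q)$, with the Lie algebroid structure transported from $E$ by the vector bundle isomorphism $((\mathrm{Id}_E,T\gamma\circ\rho),\gamma)$, and $j_\gamma:F_\gamma\to\mathcal{T}^E(E^*\times\mathbb{R})$, $i_\gamma:\gamma(Q)\to E^*\times\mathbb{R}$ are the inclusions. *)

(* Defs.v *)
From HB Require Import structures.
From mathcomp Require Import all_boot all_order all_algebra all_fingroup.
From mathcomp Require Import all_classical all_reals all_analysis.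
Set Implicit Arguments.
Unset Strict Implicit.
Unset Printing Implicit Defensive.
Import Order.TTheory GRing.Theory Num.Theory.
Import numFieldNormedType.Exports.
Local Open Scope classical_set_scope.
Local Open Scope ring_scope.

Fixpoint Ck (R : realType) (n : nat) (k : nat) (V : set 'rV[R]_n)
    (f : 'rV[R]_n -> R) : Prop :=
  match k with
  | 0 => forall y, V y -> {for y, continuous f}
  | k'.+1 => (forall y, V y -> differentiable f y) /\
             forall v : 'rV[R]_n, Ck k' V (fun y => 'D_v f y)
  end.

Definition Cinfty (R : realType) (n : nat) (V : set 'rV[R]_n)
  (f : 'rV[R]_n -> R) : Prop := forall k, Ck k V f.

(* The raw data of an atlas on a set.  The axioms are in [is_manifold], so that
   total spaces can be written down before anything is proved about them. *)
Record atlasData (R : realType) := AtlasData {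
  pt :> Type ;
  dim : nat ;
  cidx : Type ;
  cdom : cidx -> set pt ;
  cmap : cidx -> pt -> 'rV[R]_dim
}.

Section Manifolds.
Context {R : realType}.
Implicit Types M N : atlasData R.

Definition chart_img M (c : cidx M) (U : set M) : set 'rV[R]_(dim M) :=
  cmap c @` (U `&` cdom c).

(* the topology induced by the atlas *)
Definition open_in M (U : set M) : Prop :=
  forall c : cidx M, open (chart_img c U).

(* [rep c f] is f o c^-1 on the image of the chart c (and 0 elsewhere) *)
Definition rep M (c : cidx M) (f : M -> R) : 'rV[R]_(dim M) -> R :=
  fun y => xget 0 [set f x | x in [set x | cdom c x /\ cmap c x = y]].

Definition smooth_on M (U : set M) (f : M -> R) : Prop :=
  forall c : cidx M, Cinfty (chart_img c U) (rep c f).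

Definition smooth_fun M (f : M -> R) : Prop := smooth_on setT f.

Definition smooth_near M (x : M) (f : M -> R) : Prop :=
  exists U : set M, [/\ open_in U, U x & smooth_on U f].

Definition coord M (c : cidx M) (j : 'I_(dim M)) : M -> R :=
  fun x => cmap c x ord0 j.

Record is_manifold M : Prop := IsManifold {
  charts_cover : forall x : M, exists c, cdom c x ;
  chart_inj : forall (c : cidx M) (x y : M),
    cdom c x -> cdom c y -> cmap c x = cmap c y -> x = y ;
  chart_open : forall c : cidx M, open_in (cdom c) ;
  chart_compatible : forall (c : cidx M) j, smooth_on (cdom c) (coord c j) ;
  manifold_hausdorff : forall x y : M, x <> y ->
    exists U V : set M, [/\ open_in U, open_in V, U x, V y & U `&` V = set0] ;
  (* equivalent to second countability, chart domains being homeomorphic to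
     open subsets of R^n *)
  manifold_second_countable : exists D : set (cidx M),
    countable D /\ forall x : M, exists2 c, D c & cdom c x
}.

Definition smooth_map M N (F : M -> N) : Prop :=
  forall d : cidx N, open_in (F @^-1` cdom d) /\
    forall j, smooth_on (F @^-1` cdom d) (coord d j \o F).

(* Tangent vectors: derivations of germs of smooth functions at a point.  They
    are represented by functionals on all functions M -> R, with the value 0
    on functions that are not smooth near x, so that two of them are equal iff
    they agree on germs. *)

Definition is_derivation M (x : M) (v : (M -> R) -> R^o) : Prop :=
  [/\ forall f, ~ smooth_near x f -> v f = 0,
      forall (a : R) f g, smooth_near x f -> smooth_near x g ->
        v (fun y => a * f y + g y) = a * v f + v g
    & forall f g, smooth_near x f -> smooth_near x g ->
        v (fun y => f y * g y) = f x * v g + g x * v f].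

Definition derivation_pred M (x : M) : {pred (M -> R) -> R^o} :=
  fun v => `[< is_derivation x v >].

Lemma derivation_closed M (x : M) : submod_closed (derivation_pred x).
Proof.
split=> [|a u v /asboolP[u1 u2 u3] /asboolP[v1 v2 v3]]; apply/asboolP; split.
- by [].
- by move=> a f g _ _; rewrite /= mulr0 addr0.
- by move=> f g _ _; rewrite /= !mulr0 addr0.
- by move=> f fN; change (a * u f + v f = 0); rewrite u1 // v1 // mulr0 addr0.
- move=> b f h fs hs; set fh := (X in _ X = _).
  change (a * u fh + v fh = b * (a * u f + v f) + (a * u h + v h)).
  by rewrite /fh u2 // v2 // !mulrDr addrACA mulrCA.
- move=> f h fs hs; set fh := (X in _ X = _).
  change (a * u fh + v fh = f x * (a * u h + v h) + h x * (a * u f + v f)).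
  by rewrite /fh u3 // v3 // !mulrDr addrACA (mulrCA a (f x)) (mulrCA a (h x)).
Qed.

HB.instance Definition _ M (x : M) :=
  GRing.isSubmodClosed.Build R ((M -> R) -> R^o) (derivation_pred x)
    (derivation_closed x).

Record tangent M (x : M) := Tangent {
  tfun :> (M -> R) -> R^o ;
  tangentP : tfun \in derivation_pred x
}.

HB.instance Definition _ M (x : M) := [isSub for @tfun M x].
HB.instance Definition _ M (x : M) := [Choice of @tangent M x by <:].
HB.instance Definition _ M (x : M) :=
  [SubChoice_isSubLmodule of @tangent M x by <:].

(* The tangent map of F, on functionals; y stands for the image point F x. *)
Definition push M N (F : M -> N) (y : N) (v : (M -> R) -> R^o) :
    (N -> R) -> R^o :=
  fun f => if `[< smooth_near y f >] then v (f \o F) else 0.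

Lemma push_linear M N (F : M -> N) (y : N) : linear (push F y).
Proof.
move=> a u v; apply/funext => f; change (push F y (a *: u + v) f =
  a * push F y u f + push F y v f).
by rewrite /push; case: ifP => // _; rewrite mulr0 addr0.
Qed.

Lemma push0 M N (F : M -> N) (y : N) : push F y 0 = 0.
Proof. by apply/funext => f; rewrite /push; case: ifP. Qed.

Lemma tfun_linear M (x : M) (a : R) (u v : tangent x) :
  tfun (a *: u + v) = a *: tfun u + tfun v.
Proof. exact: (linearP (\val : tangent x -> _)). Qed.

Lemma tfun0 M (x : M) : tfun (0 : tangent x) = 0.
Proof. exact: (linear0 (\val : tangent x -> _)). Qed.

(* The coordinate vector of the chart c at x; [insubd 0 _] is meaningful only
   for x in the domain of c, where the functional is a derivation. *)
Definition partial M (c : cidx M) (j : 'I_(dim M)) (x : M) : tangent x :=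
  insubd 0 (fun f : M -> R =>
    if `[< smooth_near x f >] then 'D_(delta_mx ord0 j) (rep c f) (cmap c x)
    else 0 : R^o).

End Manifolds.

(* The raw data of a vector bundle: its fibres and a family of local frames.
   The axioms are in [is_vbundle]. *)
Record bundleData (R : realType) (M : atlasData R) := BundleData {
  fib :> M -> lmodType R ;
  rank : nat ;
  fidx : Type ;
  fdom : fidx -> set M ;
  frame : fidx -> 'I_rank -> forall x : M, fib x
}.

Section Bundles.
Context {R : realType}.
Implicit Types M N : atlasData R.

Definition is_basis (V : lmodType R) (m : nat) (e : 'I_m -> V) : Prop :=
  forall v : V, exists! c : 'rV[R]_m, v = \sum_i c ord0 i *: e i.

Record is_vbundle M (A : bundleData M) : Prop := IsVbundle {
  frames_cover : forall x : M, exists t : fidx A, fdom t x ;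
  frame_open : forall t : fidx A, open_in (fdom t) ;
  frame_basis : forall (t : fidx A) (x : M),
    fdom t x -> is_basis (fun i => frame t i x) ;
  frame_compatible : forall (t t' : fidx A) (a : 'I_(rank A)),
    exists g : 'I_(rank A) -> M -> R,
      (forall b, smooth_on (fdom t `&` fdom t') (g b)) /\
      forall x, fdom t x -> fdom t' x ->
        frame t' a x = \sum_b g b x *: frame t b x
}.

Definition sect M (A : bundleData M) : Type := forall x : M, A x.

Definition smooth_sect M (A : bundleData M) (s : sect A) : Prop :=
  forall t : fidx A, exists g : 'I_(rank A) -> M -> R,
    (forall b, smooth_on (fdom t) (g b)) /\
    forall x, fdom t x -> s x = \sum_b g b x *: frame t b x.

Definition TM M : bundleData M :=
  {| fib := fun x : M => (tangent x : lmodType R) ;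
     rank := dim M ;
     fidx := cidx M ;
     fdom := @cdom R M ;
     frame := @partial R M |}.

Definition args (V : lmodType R) (k : nat) (s : seq V) : 'I_k -> V :=
  fun p => nth 0 s p.

(* sections of the k-th exterior power of the dual bundle *)
Record is_form M (A : bundleData M) (k : nat)
    (mu : forall x : M, ('I_k -> A x) -> R) : Prop := IsForm {
  form_linear : forall (x : M) (a : 'I_k -> A x) (i : 'I_k) (c : R) (u v : A x),
    mu x (fun j => if j == i then c *: u + v else a j) =
      c * mu x (fun j => if j == i then u else a j) +
      mu x (fun j => if j == i then v else a j) ;
  form_alternating : forall (x : M) (a : 'I_k -> A x) (i j : 'I_k),
    i != j -> a i = a j -> mu x a = 0 ;
  form_smooth : forall (t : fidx A) (al : 'I_k -> 'I_(rank A)),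
    smooth_on (fdom t) (fun x => mu x (fun p => frame t (al p) x))
}.

Record is_bundle_morphism N M (F : bundleData N) (A : bundleData M)
    (i : N -> M) (j : forall x : N, F x -> A (i x)) : Prop := IsBundleMorphism {
  morphism_base : smooth_map i ;
  morphism_linear : forall (x : N) (c : R) (u v : F x),
    j x (c *: u + v) = c *: j x u + j x v ;
  morphism_smooth : forall (t : fidx F) (t' : fidx A) (a : 'I_(rank F)),
    exists g : 'I_(rank A) -> N -> R,
      (forall b, smooth_on (fdom t `&` i @^-1` fdom t') (g b)) /\
      forall x, fdom t x -> fdom t' (i x) ->
        j x (frame t a x) = \sum_b g b x *: frame t' b (i x)
}.

End Bundles.

(* The values of [br] matter on smooth sections only. *)
Record algebroidData (R : realType) (M : atlasData R) (A : bundleData M) :=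
  AlgebroidData {
    anchor : forall x : M, A x -> tangent x ;
    br : sect A -> sect A -> sect A
  }.
Arguments anchor {R M A} a x _.

Section Algebroids.
Context {R : realType}.
Implicit Types M N : atlasData R.

Record is_algebroid M (A : bundleData M) (L : algebroidData A) : Prop :=
  IsAlgebroid {
  anchor_linear : forall (x : M) (c : R) (u v : A x),
    anchor L x (c *: u + v) = c *: anchor L x u + anchor L x v ;
  anchor_smooth : forall s : sect A, smooth_sect s ->
    smooth_sect (A := TM M) (fun x => anchor L x (s x)) ;
  br_smooth : forall s t : sect A, smooth_sect s -> smooth_sect t ->
    smooth_sect (br L s t) ;
  br_linear : forall (c : R) (s s' t : sect A),
    smooth_sect s -> smooth_sect s' -> smooth_sect t -> forall x,
    br L (fun y => c *: s y + s' y) t x = c *: br L s t x + br L s' t x ;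
  br_antisym : forall s t : sect A, smooth_sect s -> smooth_sect t ->
    forall x, br L s t x = - br L t s x ;
  br_jacobi : forall s t u : sect A,
    smooth_sect s -> smooth_sect t -> smooth_sect u -> forall x,
    br L s (br L t u) x + br L t (br L u s) x + br L u (br L s t) x = 0 ;
  br_leibniz : forall (s t : sect A) (f : M -> R),
    smooth_sect s -> smooth_sect t -> smooth_fun f -> forall x,
    br L s (fun y => f y *: t y) x =
      f x *: br L s t x + (anchor L x (s x) f : R) *: t x
}.

Record algebroid M (A : bundleData M) := Algebroid {
  adata :> algebroidData A ;
  algebroidP : is_algebroid adata
}.

Definition dfun M (A : bundleData M) (L : algebroidData A) (f : M -> R)
  (x : M) (a : A x) : R := anchor L x a f.

(* [is_dext L mu nu]: the (k+1)-form nu is the exterior differential of the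
   k-form mu.  Indices start at 0, which does not change the parity of i + j
   but turns (-1)^(i+1) into (-1)^i. *)
Definition is_dext M (A : bundleData M) (L : algebroidData A) (k : nat)
    (mu : forall x : M, ('I_k -> A x) -> R)
    (nu : forall x : M, ('I_k.+1 -> A x) -> R) : Prop :=
  forall s : 'I_k.+1 -> sect A, (forall i, smooth_sect (s i)) -> forall x,
    nu x (fun i => s i x) =
      \sum_(i < k.+1) (-1) ^+ i *
        dfun L (fun y => mu y (fun p => s (lift i p) y)) (s i x)
      + \sum_(i < k.+1) \sum_(j < k.+1 | (i < j)%N) (-1) ^+ (i + j) *
        mu x (args (br L (s i) (s j) x ::
                    [seq s l x | l <- enum 'I_k.+1 & (l != i) && (l != j)])).

Definition is_algebroid_morphism N M (F : bundleData N) (A : bundleData M)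
    (LF : algebroidData F) (LA : algebroidData A)
    (i : N -> M) (j : forall x : N, F x -> A (i x)) : Prop :=
  is_bundle_morphism j /\
  forall (k : nat) (mu : forall x : M, ('I_k -> A x) -> R)
    (nu : forall x : M, ('I_k.+1 -> A x) -> R),
    is_form mu -> is_form nu -> is_dext LA mu nu ->
    is_dext LF (fun x (a : 'I_k -> F x) => mu (i x) (fun p => j x (a p)))
               (fun x (a : 'I_k.+1 -> F x) => nu (i x) (fun p => j x (a p))).

Record is_subalgebroid N M (F : bundleData N) (A : bundleData M)
    (LF : algebroidData F) (LA : algebroidData A)
    (i : N -> M) (j : forall x : N, F x -> A (i x)) : Prop := IsSubalgebroid {
  sub_manifold : is_manifold N ;
  sub_vbundle : is_vbundle F ;
  sub_algebroid : is_algebroid LF ;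
  sub_morphism : is_algebroid_morphism LF LA j ;
  sub_mono : forall x : N, injective (j x) ;
  sub_inj : injective i ;
  sub_immersion : forall (x : N) (v w : tangent x),
    push i (i x) v = push i (i x) w -> v = w
}.

(* The last clause is the nonvanishing of eta /\ (d eta)^k, written out (up to a
   nonzero constant) as an alternating sum over permutations. *)
Record is_contact M (A : bundleData M) (L : algebroidData A) (k : nat)
    (eta : forall x : M, ('I_1 -> A x) -> R) : Prop := IsContact {
  contact_rank : rank A = k.*2.+1 ;
  contact_form : is_form eta ;
  contact_nondegenerate : forall deta : forall x : M, ('I_2 -> A x) -> R,
    is_form deta -> is_dext L eta deta ->
    forall x : M, exists w : 'I_k.*2.+1 -> A x,
      \sum_(s : 'S_k.*2.+1) (-1) ^+ s *
        (eta x (args [:: w (s ord0)]) *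
         \prod_(i < k) deta x (args [:: w (s (inord i.*2.+1));
                                        w (s (inord i.*2.+2))])) != 0
}.

Record is_legendrian N M (F : bundleData N) (A : bundleData M)
    (LF : algebroidData F) (LA : algebroidData A)
    (i : N -> M) (j : forall x : N, F x -> A (i x)) (k : nat)
    (eta : forall x : M, ('I_1 -> A x) -> R) : Prop := IsLegendrian {
  legendrian_contact : is_contact LA k eta ;
  legendrian_sub : is_subalgebroid LF LA j ;
  legendrian_dim : forall x : N, exists e : 'I_k -> F x, is_basis e ;
  legendrian_eta : forall (x : N) (a : F x), eta (i x) (args [:: j x a]) = 0
}.

Definition is_reeb M (A : bundleData M)
    (eta : forall x : M, ('I_1 -> A x) -> R)
    (deta : forall x : M, ('I_2 -> A x) -> R) (r : sect A) : Prop :=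
  [/\ smooth_sect r,
      forall (x : M) (w : A x), deta x (args [:: r x; w]) = 0
    & forall x : M, eta x (args [:: r x]) = 1].

Definition is_hamiltonian M (A : bundleData M) (L : algebroidData A)
    (eta : forall x : M, ('I_1 -> A x) -> R)
    (deta : forall x : M, ('I_2 -> A x) -> R) (r : sect A)
    (H : M -> R) (xi : sect A) : Prop :=
  [/\ smooth_sect xi,
      forall x : M, eta x (args [:: xi x]) = - H x
    & forall (x : M) (w : A x), deta x (args [:: xi x; w]) =
        dfun L H w - dfun L H (r x) * eta x (args [:: w])].

(* [[s, t]] = r for local sections s, t, r over the open set U: the equality
   holds on every open V for all global smooth sections extending s, t from V *)
Definition local_br M (A : bundleData M) (L : algebroidData A) (U : set M)
    (s t r : sect A) : Prop :=
  forall (V : set M) (S T : sect A), open_in V -> V `<=` U ->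
    smooth_sect S -> smooth_sect T ->
    (forall x, V x -> S x = s x) -> (forall x, V x -> T x = t x) ->
    forall x, V x -> br L S T x = r x.

Definition is_structure_functions M (A : bundleData M) (L : algebroidData A)
    (t : fidx A) (U : set M) (C : 'I_(rank A) -> 'I_(rank A) ->
      'I_(rank A) -> M -> R) : Prop :=
  forall a b, local_br L U (frame t a) (frame t b)
    (fun x => \sum_g C a b g x *: frame t g x).

End Algebroids.

Section DualTimesR.
Context {R : realType} {Q : atlasData R} (E : bundleData Q).

Definition dualR_pt : Type := {q : Q & {scalar E q}} * R.

(* the coordinates (q^i, y_alpha, s), with y_alpha (b) = b (e_alpha) *)
Definition dualR : atlasData R :=
  {| pt := dualR_pt ;
     dim := dim Q + rank E + 1 ;
     cidx := cidx Q * fidx E ;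
     cdom := fun ct => [set x : dualR_pt |
       cdom ct.1 (projT1 x.1) /\ fdom ct.2 (projT1 x.1)] ;
     cmap := fun ct (x : dualR_pt) =>
       row_mx (row_mx (cmap ct.1 (projT1 x.1))
                (\row_(a < rank E) projT2 x.1 (frame ct.2 a (projT1 x.1))))
              (const_mx x.2) |}.

Definition dualR_pi (x : dualR) : Q := projT1 x.1.

(* sections of [dualR_pi] are dependent functions; this is the underlying map *)
Definition sect_map (g : forall q : Q, {scalar E q} * R) (q : Q) : dualR :=
  (existT _ q (g q).1, (g q).2).

End DualTimesR.

Section ProlongationFibre.
Context {R : realType} {Q : atlasData R} {E : bundleData Q}.
Variables (L : algebroid E) (x : dualR E).

Definition prol_pred : {pred (E (dualR_pi x) * tangent x)%type} :=
  fun w => `[< tfun (anchor L (dualR_pi x) w.1) =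
               push (@dualR_pi R Q E) (dualR_pi x) (tfun w.2) >].

Lemma prol_closed : submod_closed prol_pred.
Proof.
have [al _ _ _ _ _ _] := algebroidP L.
have a0 : anchor L (dualR_pi x) 0 = 0.
  by move: (al (dualR_pi x) (-1) 0 0); rewrite scaleN1r oppr0 addr0 scaleN1r addNr.
split=> [|a u v /asboolP hu /asboolP hv]; apply/asboolP.
  by rewrite a0 !tfun0 push0.
by rewrite al !tfun_linear push_linear hu hv.
Qed.

HB.instance Definition _ :=
  GRing.isSubmodClosed.Build R (E (dualR_pi x) * tangent x)%type prol_pred
    prol_closed.

Record prol_fib := ProlFib {
  prol_val :> E (dualR_pi x) * tangent x ;
  prol_valP : prol_val \in prol_pred
}.

HB.instance Definition _ := [isSub for prol_val].
HB.instance Definition _ := [Choice of prol_fib by <:].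
HB.instance Definition _ := [SubChoice_isSubLmodule of prol_fib by <:].

End ProlongationFibre.

Section Prolongation.
Context {R : realType} {Q : atlasData R} {E : bundleData Q}.
Variable L : algebroid E.
Implicit Types (x : dualR E) (ct : cidx (dualR E)).

Definition pr1 x (w : prol_fib L x) : E (dualR_pi x) := (prol_val w).1.

(* The local basis X~_alpha, V~^alpha, V~_s.  The uses of [insubd] are
   meaningful only over the domain of the chart ct, where the pairs belong to
   the fibre.  The coefficient rho^i_alpha is rho(e_alpha)(q^i). *)
Definition prolX ct (a : 'I_(rank E)) x : prol_fib L x :=
  let q := dualR_pi x in
  insubd 0 (frame ct.2 a q,
    \sum_(i < dim Q) (anchor L q (frame ct.2 a q) (coord ct.1 i) : R) *:
      partial ct (lshift 1 (lshift (rank E) i)) x).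

Definition prolV ct (a : 'I_(rank E)) x : prol_fib L x :=
  insubd 0 (0, partial ct (lshift 1 (rshift (dim Q) a)) x).

Definition prolVs ct x : prol_fib L x :=
  insubd 0 (0, partial ct (rshift (dim Q + rank E) ord0) x).

Definition prolongation : bundleData (dualR E) :=
  {| fib := fun x => (prol_fib L x : lmodType R) ;
     rank := rank E + rank E + 1 ;
     fidx := cidx (dualR E) ;
     fdom := @cdom R (dualR E) ;
     frame := fun ct r x =>
       match fintype.split r with
       | inl r' => match fintype.split r' with
                   | inl a => prolX ct a x
                   | inr a => prolV ct a x
                   end
       | inr _ => prolVs ct x
       end |}.

(* The brackets of basis sections determine LP by the Leibniz rule; those not
   listed follow by antisymmetry. *)
Record is_prolongation (LP : algebroid prolongation) : Prop := IsProlongation {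
  prol_anchor : forall x (w : prolongation x), anchor LP x w = (prol_val w).2 ;
  prol_brXX : forall ct C,
    is_structure_functions L ct.2 (cdom ct.1 `&` fdom ct.2) C ->
    forall a b, local_br LP (cdom ct) (prolX ct a) (prolX ct b)
      (fun x => \sum_g C a b g (dualR_pi x) *: prolX ct g x) ;
  prol_brXV : forall ct a b,
    local_br LP (cdom ct) (prolX ct a) (prolV ct b) (fun x => 0) ;
  prol_brXVs : forall ct a,
    local_br LP (cdom ct) (prolX ct a) (prolVs ct) (fun x => 0) ;
  prol_brVV : forall ct a b,
    local_br LP (cdom ct) (prolV ct a) (prolV ct b) (fun x => 0) ;
  prol_brVVs : forall ct a,
    local_br LP (cdom ct) (prolV ct a) (prolVs ct) (fun x => 0)
}.

Definition contact_eta : forall x, ('I_1 -> prolongation x) -> R :=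
  fun x w => ((prol_val (w ord0)).2 : tangent x) (fun y : dualR E => y.2)
             - projT2 x.1 (pr1 (w ord0)).

Definition evolution_sect (H : dualR E -> R) (r xi : sect prolongation) :
    sect prolongation :=
  fun x => xi x + H x *: r x.

Variable g : forall q : Q, {scalar E q} * R.

(* The map a |-> (a, T gamma (rho a)), at a point x of the image of gamma. *)
Definition graph_lift x (a : E (dualR_pi x)) : prol_fib L x :=
  insubd 0 (a, insubd 0 (push (sect_map g) x (anchor L (dualR_pi x) a))).

End Prolongation.

Section GraphFibre.
Context {R : realType} {Q : atlasData R} {E : bundleData Q}.
Variables (L : algebroid E) (g : forall q : Q, {scalar E q} * R) (x : dualR E).

Definition graph_pred : {pred prol_fib L x} :=
  fun w => `[< tfun (prol_val w).2 =
               push (sect_map g) x (anchor L (dualR_pi x) (pr1 w)) >].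

Lemma graph_closed : submod_closed graph_pred.
Proof.
have [al _ _ _ _ _ _] := algebroidP L.
have a0 : anchor L (dualR_pi x) 0 = 0.
  by move: (al (dualR_pi x) (-1) 0 0); rewrite scaleN1r oppr0 addr0 scaleN1r addNr.
split=> [|a u v /asboolP hu /asboolP hv]; apply/asboolP.
  by rewrite /pr1 /= a0 !tfun0 push0.
by rewrite /pr1 /= al !tfun_linear push_linear hu hv.
Qed.

HB.instance Definition _ :=
  GRing.isSubmodClosed.Build R (prol_fib L x) graph_pred graph_closed.

Record graph_fib := GraphFib {
  graph_val :> prol_fib L x ;
  graph_valP : graph_val \in graph_pred
}.

HB.instance Definition _ := [isSub for graph_val].
HB.instance Definition _ := [Choice of graph_fib by <:].
HB.instance Definition _ := [SubChoice_isSubLmodule of graph_fib by <:].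

End GraphFibre.

Section Graph.
Context {R : realType} {Q : atlasData R} {E : bundleData Q}.
Variables (L : algebroid E) (g : forall q : Q, {scalar E q} * R).

Definition graph_pt : Type := {x : dualR E | exists q, x = sect_map g q}.

(* gamma (Q), with the manifold structure transported from Q by gamma, whose
   inverse is the restriction of pi *)
Definition graph_base : atlasData R :=
  {| pt := graph_pt ;
     dim := dim Q ;
     cidx := cidx Q ;
     cdom := fun c => [set y : graph_pt | cdom c (dualR_pi (sval y))] ;
     cmap := fun c (y : graph_pt) => cmap c (dualR_pi (sval y)) |}.

Definition to_graph (q : Q) : graph_base :=
  exist _ (sect_map g q) (ex_intro _ q erefl).

Definition graph_iso (y : graph_base) (a : E (dualR_pi (sval y))) :
    graph_fib L g (sval y) :=
  insubd 0 (graph_lift L g a).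

Definition graph_bundle : bundleData graph_base :=
  {| fib := fun y : graph_base => (graph_fib L g (sval y) : lmodType R) ;
     rank := rank E ;
     fidx := fidx E ;
     fdom := fun t => [set y : graph_base | fdom t (dualR_pi (sval y))] ;
     frame := fun t a (y : graph_base) =>
       graph_iso (frame t a (dualR_pi (sval y))) |}.

Definition graph_sect (s : sect graph_bundle) : sect E :=
  fun q => pr1 (graph_val (s (to_graph q))).

Definition graph_algebroid : algebroidData graph_bundle :=
  {| anchor := fun (y : graph_base) (w : graph_bundle y) =>
       insubd 0 (push to_graph y
         (anchor L (dualR_pi (sval y)) (pr1 (graph_val w)))) ;
     br := fun s t (y : graph_base) =>
       graph_iso (br L (graph_sect s) (graph_sect t) (dualR_pi (sval y))) |}.

Definition graph_i : graph_base -> dualR E := fun y => sval y.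

Definition graph_j (y : graph_base) :
    graph_bundle y -> prolongation L (graph_i y) := fun w => graph_val w.

End Graph.

(* Main.v *)
From Pilot Require Import Defs.
From HB Require Import structures.
From mathcomp Require Import all_boot all_order all_algebra all_fingroup.
From mathcomp Require Import all_classical all_reals all_analysis.
From mathcomp Require Import ring lra.
(* again, so that [coord] denotes the coordinates of a chart *)
Import Pilot.Defs.
Set Implicit Arguments.
Unset Strict Implicit.
Unset Printing Implicit Defensive.
Import Order.TTheory GRing.Theory Num.Theory.
Import numFieldNormedType.Exports.
Local Open Scope classical_set_scope.
Local Open Scope ring_scope.

(** Write F for the graph {(a, T gamma (rho a))}, a subbundle of the prolongation
    A over the image of gamma, and Ev for the evolution section. Since
    i_R (d eta) = 0 and eta vanishes on F, the equation of the Hamiltonian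
    section gives, for every w = (a, T gamma (rho a)) in F,

        d eta (Ev, w) = dH (w) = rho (a) (H o gamma).

    So d^E (H o gamma) = 0 says that Ev is orthogonal to F for d eta along gamma,
    and the theorem amounts to saying that a vector of ker eta orthogonal to F is
    in F. Note that eta (Ev) = - H + H = 0.

    - If Ev is in F, it is orthogonal to F because F is isotropic: the inclusion
      of F is a morphism, so the pull-back of d eta is the differential of the
      pull-back of eta, which is 0 ([graph_isotropic]).

    - Conversely, let w0 be the vector of F over pr1 (Ev); it exists because the
      first projection maps the frames of F onto those of E
      ([graph_lift_onto]). The difference u = Ev - w0 is vertical, lies in ker eta
      and is orthogonal to F. In the local frame X_a, V_a, V_s the only nonzero
      values of d eta against vertical vectors of ker eta are
      d eta (X_b, V_a) = delta_ab ([deta_XV], [deta_VV], [deta_VsV]), so pairing u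
      with the vector of F over e_b yields its coefficient on V_b
      ([vertical_orthogonal_eq0]), and u = 0.

    The differential of a form and the bracket are specified only on global smooth
    sections, while these arguments are pointwise or take place in a local frame.
    Most of the work is therefore to extend local sections: smooth cut-off
    functions exist on every Hausdorff manifold ([bump_rV], [cutoff]), so that
    sections can be extended ([extend_sect]). This is applied to E, to F and to
    the prolongation; for the last one it requires that E^* x R is a Hausdorff
    manifold ([dualR_atlas], [dualR_separated]) and that the frames of the
    prolongation change smoothly from one chart to another
    ([prolongation_compatible]). The functions x^-m exp(-1/x) are the source of all
    cut-off functions. *)

(** * Iterated derivatives on R^n *)

Lemma near_eq_continuous (T U : topologicalType) (f g : T -> U) (x : T) :
  (\near x, f x = g x) -> {for x, continuous f} -> {for x, continuous g}.
Proof.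
move=> fg fc; rewrite /prop_for /continuous_at -(nbhs_singleton fg).
by apply: cvg_trans fc; apply: near_eq_cvg; apply: filterS fg => y.
Qed.

Lemma near_eq_differentiable (R : numFieldType) (V W : normedModType R)
    (f g : V -> W) (x : V) :
  (\near x, f x = g x) -> differentiable f x -> differentiable g x.
Proof.
move=> fg df.
have -> : g = f + (g - f) by apply/funext => y; rewrite /= addrC subrK.
apply: differentiableD => //.
apply/diffP => /=.
apply: (@getPex _ (fun (df : {linear V -> W}) => continuous df /\
  forall y, (g - f) y = (g - f) (lim (nbhs x)) + df (y - lim (nbhs x))
                  +o_(y \near x) (y - lim (nbhs x)))).
exists (\0 : {linear V -> W}); split; first exact: cst_continuous.
rewrite lim_id //.
suff: (g - f) = (fun y => (g - f) x + (\0 : {linear V -> W}) (y - x))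
    +o_ (nbhs x) (fun y => y - x) by rewrite funeqE.
apply/eqaddoP => e e0; near=> y.
rewrite /= -![(_ + _) _]/(_ + _) /= -![(- _) _]/(- _) /=.
rewrite (nbhs_singleton fg) subrr addr0 subr0.
have -> : f y = g y by near: y.
by rewrite subrr normr0 mulr_ge0 // ltW.
Unshelve. all: by end_near. Qed.

Lemma derive_coord (R : realType) n (y v : 'rV[R]_n) (i : 'I_n) :
  'D_v (fun z : 'rV[R]_n => z ord0 i) y = v ord0 i.
Proof.
rewrite deriveE; last exact: differentiable_coord.
pose f : 'rV[R]_n -> R := fun M => M ord0 i.
have fl : linear f by move=> a u w; rewrite /f !mxE.
pose fL := GRing.isLinear.Build _ _ _ _ f fl.
pose F : {linear 'rV[R]_n -> R} := HB.pack f fL.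
by rewrite (_ : (fun _ => _) = F) // diff_lin //; exact: coord_continuous.
Qed.

Section IteratedDerivatives.
Context {R : realType} {n : nat}.
Implicit Types (V W : set 'rV[R]_n) (f g : 'rV[R]_n -> R).

Lemma Ck_sub k V W f : W `<=` V -> Ck k V f -> Ck k W f.
Proof.
move=> WV; elim: k f => [|k IH] f /=; first by move=> fc y /WV; exact: fc.
by move=> [fd fD]; split=> [y /WV|v]; [exact: fd | exact: IH].
Qed.

Lemma Ck_pred k V f : Ck k.+1 V f -> Ck k V f.
Proof.
elim: k f => [|k IH] f /= [fd fD].
  by move=> y Vy; exact/differentiable_continuous/fd.
by split=> // v; apply: IH; exact: fD.
Qed.

Lemma eq_Ck k V f g : open V -> (forall y, V y -> f y = g y) ->
  Ck k V f -> Ck k V g.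
Proof.
move=> oV; elim: k f g => [|k IH] f g fg.
all: have N y : V y -> \forall z \near y, f z = g z
  by move=> Vy; apply: filterS fg _; exact: open_nbhs_nbhs.
  move=> fc y Vy.
  exact: near_eq_continuous (N y Vy) (fc y Vy).
move=> [fd fD]; split=> [y Vy|v].
  by apply: near_eq_differentiable (fd y Vy); exact: N.
by apply: IH (fD v) => y Vy; exact/near_eq_derive/N.
Qed.

(** Both clauses of [Ck] are conditions at single points, so smoothness glues. *)
Lemma Ck_local k V f :
  (forall y, V y -> exists W, [/\ W y & Ck k W f]) -> Ck k V f.
Proof.
elim: k f => [|k IH] f Vf /=; first by move=> y /Vf[W [Wy]]; exact.
split=> [y /Vf[W [Wy]] [fd _]|v]; first exact: fd.
by apply: IH => y /Vf[W [Wy] [_ fD]]; exists W; split => //; exact: fD.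
Qed.

Lemma Ck_cst k V (a : R) : Ck k V (fun=> a).
Proof.
elim: k a => [|k IH] a /=; first by move=> y _; exact: cst_continuous.
split=> [y _|v]; first exact: differentiable_cst.
by have -> : (fun y => 'D_v (fun=> a : R) y) = fun=> 0
  by apply/funext => y; rewrite derive_cst.
Qed.

Lemma CkD k V f g : open V -> Ck k V f -> Ck k V g ->
  Ck k V (fun y => f y + g y).
Proof.
move=> oV; elim: k f g => [|k IH] f g /=.
  by move=> fc gc y Vy; exact: continuousD (fc y Vy) (gc y Vy).
move=> [fd fD] [gd gD]; split=> [y Vy|v].
  by apply: differentiableD; [exact: fd | exact: gd].
apply: eq_Ck (IH _ _ (fD v) (gD v)) => // y Vy.
by rewrite -deriveD //; apply: diff_derivable; [exact: fd | exact: gd].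
Qed.

Lemma CkM k V f g : open V -> Ck k V f -> Ck k V g ->
  Ck k V (fun y => f y * g y).
Proof.
move=> oV; elim: k f g => [|k IH] f g.
  by move=> /= fc gc y Vy; exact: continuousM (fc y Vy) (gc y Vy).
move=> fk gk; have [[fd fD] [gd gD]] := (fk, gk); split=> [y Vy|v].
  by apply: differentiableM; [exact: fd | exact: gd].
apply: eq_Ck (CkD oV (IH _ _ (Ck_pred fk) (gD v)) (IH _ _ (Ck_pred gk) (fD v))) => //.
move=> y Vy; have := @deriveM _ _ f g y v.
by move=> -> //; apply: diff_derivable; [exact: fd | exact: gd].
Qed.

(** The derivative of 1 / f is - (1 / f) (1 / f) D f, so smoothness of 1 / f
    follows by induction from that of its own lower derivatives. *)
Lemma CkV k V f : open V -> (forall y, V y -> f y != 0) -> Ck k V f ->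
  Ck k V (fun y => (f y)^-1).
Proof.
move=> oV f0; elim: k => [|k IH].
  by move=> /= fc y Vy; exact: continuousV (f0 y Vy) (fc y Vy).
move=> fk; have [fd fD] := fk; have iV := IH (Ck_pred fk).
split=> [y Vy|v]; first by apply: differentiableV; [exact: fd|exact: f0].
apply: eq_Ck (CkM oV (Ck_cst k V (-1)) (CkM oV (CkM oV iV iV) (fD v))) => // y Vy.
have := @deriveV _ _ f y v (f0 y Vy) (diff_derivable (fd y Vy)).
by move=> ->; rewrite mulN1r expr2 invfM /GRing.scale /= mulNr.
Qed.

Lemma Ck_sum k V m (F : 'I_m -> 'rV[R]_n -> R) : open V ->
  (forall i, Ck k V (F i)) -> Ck k V (fun y => \sum_i F i y).
Proof.
move=> oV Fk.
have -> : (fun y => \sum_i F i y) = \big[(fun f g y => f y + g y)/fun=> 0]_i F i.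
  by apply/funext => y; elim/big_rec2: _ => // i a b _ ->.
by elim/big_ind: _ => [|f g|i _] //; [exact: Ck_cst|exact: CkD].
Qed.

Lemma Ck_coord k V (i : 'I_n) : Ck k V (fun y : 'rV[R]_n => y ord0 i).
Proof.
case: k => [|k]; first by move=> y _; exact: coord_continuous.
split=> [y _|v]; first exact: differentiable_coord.
have -> : (fun y => 'D_v (fun y : 'rV[R]_n => y ord0 i) y) = fun=> v ord0 i.
  by apply/funext => y; rewrite derive_coord.
exact: Ck_cst.
Qed.

End IteratedDerivatives.

(** * Chain rule *)

Section ChainRule.
Context {R : realType} {n m : nat}.
Variable T : 'rV[R]_n -> 'rV[R]_m.

Lemma differentiable_rV y :
  (forall j, differentiable (fun z => T z ord0 j) y) -> differentiable T y.
Proof.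
move=> Td.
have -> : T = \sum_(j < m) (fun z => T z ord0 j *: delta_mx ord0 j).
  by apply/funext => z; rewrite fct_sumE -row_sum_delta.
by apply: differentiable_sum => j; exact: differentiableZl.
Qed.

Lemma derive_comp_rV (F : 'rV[R]_m -> R) y v :
  differentiable F (T y) -> (forall j, differentiable (fun z => T z ord0 j) y) ->
  'D_v (F \o T) y =
    \sum_j 'D_(delta_mx ord0 j) F (T y) * 'D_v (fun z => T z ord0 j) y.
Proof.
move=> Fd Td; have dT := differentiable_rV Td.
rewrite deriveE; last exact: differentiable_comp.
rewrite diff_comp //= -(deriveE v dT) derive_mx; last exact: diff_derivable.
rewrite [X in 'd F _ X]row_sum_delta linear_sum; apply: eq_bigr => j _.
by rewrite linearZ /= mxE -deriveE // mulrC.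
Qed.

(** Induction on the order for all F at once: by the chain rule the derivative of
    F o T is a combination of the partial derivatives of F composed with T. *)
Lemma Ck_comp k V W (F : 'rV[R]_m -> R) :
  open V -> (forall y, V y -> W (T y)) ->
  (forall j, Ck k V (fun z => T z ord0 j)) -> Ck k W F -> Ck k V (F \o T).
Proof.
move=> oV VW; elim: k F => [|k IH] F Tk Fk.
  move=> y Vy; apply: continuous_comp; last exact/Fk/VW.
  have -> : T = \sum_(j < m) (fun z => T z ord0 j *: delta_mx ord0 j).
    by apply/funext => z; rewrite fct_sumE -row_sum_delta.
  elim/big_ind: _ => [|f g|j _]; first exact: cst_continuous.
    exact: continuousD.
  by apply: continuousZr_tmp; exact: Tk.
have [Fd FD] := Fk.
have Td j y : V y -> differentiable (fun z => T z ord0 j) y.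
  by move=> Vy; have [+ _] := Tk j; apply.
split=> [y Vy|v].
  by apply: differentiable_comp; [apply: differentiable_rV => j; exact: Td | exact/Fd/VW].
apply: (@eq_Ck _ _ _ _ (fun y => \sum_j 'D_(delta_mx ord0 j) F (T y) *
    'D_v (fun z => T z ord0 j) y)) => //.
  move=> y Vy; rewrite derive_comp_rV //; first exact/Fd/VW.
  by move=> j; exact: Td.
apply: Ck_sum => // j; apply: CkM => //; last by have [_] := Tk j; apply.
exact: (IH _ (fun i => Ck_pred (Tk i)) (FD (delta_mx ord0 j))).
Qed.

End ChainRule.

(** Along a line on which T is affine the difference quotients of F o T and of F
    are the same functions of the parameter. *)
Lemma derive_affine (R : realType) n m (F : 'rV[R]_m -> R) (T : 'rV[R]_n -> 'rV[R]_m)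
    y v w : (forall t : R, T (t *: v + y) = t *: w + T y) ->
  'D_v (F \o T) y = 'D_w F (T y).
Proof.
by move=> Tvw; rewrite /derive; under eq_fun => t do rewrite /= Tvw.
Qed.

(** * Cut-off functions on R^n *)

Section Flat.
Context {R : realType}.

(** The functions x^-m exp(-1/x), extended by 0: the parameter m makes the family
    stable under derivation up to linear combinations. *)
Definition flat (m : nat) (x : R) : R :=
  if 0 < x then x^-1 ^+ m * expR (- x^-1) else 0.

Lemma flat_le0 m x : x <= 0 -> flat m x = 0.
Proof. by rewrite /flat ltNge => ->. Qed.

Lemma flat_gt0 m x : 0 < x -> 0 < flat m x.
Proof. by move=> x0; rewrite /flat x0 mulr_gt0 ?expR_gt0 // exprn_gt0 // invr_gt0. Qed.

Lemma flat_ge0 m x : 0 <= flat m x.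
Proof.
by case: (leP x 0) => x0; [rewrite flat_le0|exact/ltW/flat_gt0].
Qed.

(** The exponential dominates its Taylor terms, here 1/x to the power m + 2; the
    quadratic bound makes the derivative at 0 vanish. *)
Lemma flat_bound m x : flat m x <= (m.+2)`!%:R * x ^+ 2.
Proof.
case: (leP x 0) => x0; first by rewrite flat_le0 // mulr_ge0 ?sqr_ge0.
have F0 : 0 < (m.+2)`!%:R :> R by rewrite ltr0n fact_gt0.
have e : x^-1 ^+ m.+2 <= (m.+2)`!%:R * expR (x^-1).
  rewrite mulrC -ler_pdivrMr //.
  by apply: le_trans (expR_ge1Dxn m.+1 _); rewrite ?lerDr // invr_ge0 ltW.
rewrite /flat x0 expRN ler_pdivrMr ?expR_gt0 // mulrAC.
have -> : x^-1 ^+ m = x^-1 ^+ m.+2 * x ^+ 2.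
  by rewrite -addn2 exprD -mulrA -exprMn mulVf ?expr1n ?mulr1 // lt0r_neq0.
by rewrite ler_wpM2r ?sqr_ge0.
Qed.

Lemma is_derive_flat m (x : R) :
  is_derive x 1 (flat m) (flat m.+2 x - m%:R * flat m.+1 x).
Proof.
have [x0|x0|->] := ltgtP x 0.
- rewrite !flat_le0 ?(ltW x0) // mulr0 subr0.
  apply: near_eq_is_derive (is_derive_cst 0 x 1).
  by near=> y; rewrite flat_le0 // ltW //; near: y; exact: lt_nbhsl.
- have x1 := lt0r_neq0 x0.
  have dV : is_derive x 1 (fun y : R => y^-1) (- x ^- 2).
    by apply: is_derive_eq (is_deriveV x1 (is_derive_id x 1)) _; rewrite /GRing.scale /= mulr1.
  have dE : is_derive x 1 (fun y : R => expR (- y^-1)) (x ^- 2 * expR (- x^-1)).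
    have dN := is_deriveN dV.
    have := @is_derive1_comp R expR (fun y => - y^-1) x _ _ (is_derive_expR _) dN.
    by move/is_derive_eq; apply; rewrite opprK mulrC.
  have dX : is_derive x 1 (fun y : R => y^-1 ^+ m) (- (m%:R * x^-1 ^+ m.+1)).
    have := is_deriveX m dV.
    rewrite exprfctE => /is_derive_eq; apply.
    rewrite /GRing.scale /= mulrN -mulrA -exprVn -exprD.
    by case: (m) => [|k]; rewrite ?mul0r // addn2.
  have dM := is_deriveM dX dE.
  apply: near_eq_is_derive (is_derive_eq dM _).
    near=> y; rewrite /flat ifT //.
    by near: y; exact: (open_nbhs_nbhs (conj (@open_gt R 0) x0)).
  rewrite /flat x0 /GRing.scale /= -[x ^- 2]exprVn mulrA -exprD addn2.
  by rewrite mulrN [expR _ * _]mulrC mulrA.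
- rewrite !flat_le0 // mulr0 subr0.
  have L : h^-1 *: ((flat m \o shift 0) (h *: 1) - flat m 0) @[h --> 0^'] --> (0 : R).
    apply/cvgrPdist_le => e e0; near=> h.
    rewrite /= addr0 /GRing.scale /= mulr1 (@flat_le0 _ 0) // subr0 sub0r normrN.
    rewrite normrM normfV ger0_norm ?flat_ge0 // mulrC.
    have h0 : 0 < `|h| by rewrite normr_gt0; near: h; exact: nbhs_dnbhs_neq.
    rewrite ler_pdivrMr //; apply: le_trans (flat_bound _ _) _.
    rewrite -real_normK ?num_real // expr2 mulrA ler_wpM2r //.
    rewrite mulrC -ler_pdivlMr ?ltr0n ?fact_gt0 //.
    near: h; apply: dnbhs0_le; by rewrite divr_gt0 // ltr0n fact_gt0.
  apply: DeriveDef; first by apply/cvg_ex; exists 0.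
  exact: cvg_lim L.
Unshelve. all: by end_near. Qed.

End Flat.
Section Bump.
Context {R : realType} {n : nat}.

(** All m are treated together, since deriving raises m. *)
Lemma Ck_flat k m (V : set 'rV[R]_n) (p : 'rV[R]_n -> R) :
  open V -> Ck k V p -> Ck k V (flat m \o p).
Proof.
move=> oV; elim: k m => [|k IH] m pk.
  move=> y Vy; apply: continuous_comp; first exact: pk.
  apply/differentiable_continuous/derivable1_diffP.
  by case: (is_derive_flat m (p y)).
have [pd pD] := pk.
have hd x : differentiable (flat m : R -> R) x.
  by apply/derivable1_diffP; case: (is_derive_flat m x).
have hE x w : 'd (flat m : R -> R) x w = w * (flat m.+2 x - m%:R * flat m.+1 x).
  rewrite -[in LHS](mulr1 w) -[w * 1]/(w *: 1) linearZ /= -deriveE //.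
  by case: (is_derive_flat m x) => _ ->.
split=> [y Vy|v]; first by apply: differentiable_comp => //; exact: pd.
have pk' := Ck_pred pk.
apply: (eq_Ck oV) (CkM oV (CkD oV (IH m.+2 pk')
  (CkM oV (Ck_cst k V (- m%:R)) (IH m.+1 pk'))) (pD v)) => y Vy.
rewrite (deriveE v (pd y Vy)) (@deriveE _ _ _ (flat m \o p)); last first.
  by apply: differentiable_comp => //; exact: pd.
rewrite (@diff_comp _ _ _ _ p (flat m)) //; last exact: pd.
by rewrite [RHS]/= hE /= mulrC mulNr.
Qed.

Definition step (t : R) : R := flat 0 t / (flat 0 t + flat 0 (1 - t)).

Lemma step_le0 t : t <= 0 -> step t = 0.
Proof. by move=> t0; rewrite /step flat_le0 // mul0r. Qed.

Lemma step_den_gt0 (t : R) : 0 < flat 0 t + flat 0 (1 - t) :> R.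
Proof.
case: (leP t 0) => t0; last by rewrite ltr_wpDr ?flat_ge0 // flat_gt0.
by rewrite ltr_wpDl ?flat_ge0 // flat_gt0 //; lra.
Qed.

Lemma step_ge1 t : 1 <= t -> step t = 1.
Proof.
move=> t1; rewrite /step (@flat_le0 _ _ (1 - t)) ?subr_le0 // addr0 divff //.
by apply/lt0r_neq0/flat_gt0; lra.
Qed.

Lemma Ck_step k (V : set 'rV[R]_n) (p : 'rV[R]_n -> R) :
  open V -> Ck k V p -> Ck k V (step \o p).
Proof.
move=> oV pk.
have p1 : Ck k V (fun y => 1 - p y).
  apply: (eq_Ck oV) (CkD oV (Ck_cst k V 1) (CkM oV (Ck_cst k V (-1)) pk)) => y _.
  by rewrite mulN1r.
apply: (CkM oV (Ck_flat 0 oV pk)); apply: CkV => //.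
  by move=> y _; exact/lt0r_neq0/step_den_gt0.
exact: CkD oV (Ck_flat 0 oV pk) (Ck_flat 0 oV p1).
Qed.

(** A smooth step applied to 2 - |y - a|^2 / r^2, which exceeds 1 near a and is
    negative outside the cube of half-side 2 r. *)
Lemma bump_rV (a : 'rV[R]_n) (W : set 'rV[R]_n) : open W -> W a ->
  exists (chi : 'rV[R]_n -> R) (K : set 'rV[R]_n), [/\ Cinfty setT chi,
    \forall y \near a, chi y = 1, compact K, K `<=` W &
    forall y, ~ K y -> chi y = 0].
Proof.
move=> oW Wa.
have /nbhs_ballP[e /= e0 eW] : nbhs a W by exact: open_nbhs_nbhs.
(* then the cube of half-side 2 r lies in the ball of radius e *)
pose r := e / 4.
have r0 : 0 < r by rewrite divr_gt0.
pose d (y : 'rV[R]_n) := \sum_i (y ord0 i - a ord0 i) ^+ 2.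
have dk k : Ck k setT d.
  apply: Ck_sum => [|i]; first exact: openT.
  have c : Ck k setT (fun y : 'rV[R]_n => y ord0 i - a ord0 i).
    by apply: CkD; [exact: openT|exact: Ck_coord|exact: Ck_cst].
  by apply: CkM => //; exact: openT.
have d0 : d a = 0 by rewrite /d big1 // => i _; rewrite subrr expr0n.
pose p y := 2 - d y / r ^+ 2.
have pk k : Ck k setT p.
  apply: (eq_Ck openT) (CkD openT (Ck_cst k setT 2) (CkM openT (Ck_cst k setT (- r ^- 2)) (dk k))).
  by move=> y _; rewrite /p mulNr mulrC.
exists (step \o p), [set y | forall i, `[a ord0 i - 2 * r, a ord0 i + 2 * r]%classic (y ord0 i)].
split.
- by move=> k; apply: Ck_step (pk k); exact: openT.
- have p1 : \forall y \near a, 1 < p y.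
    have : {for a, continuous p} by apply: (pk 0%N).
    move=> /(_ [set t | 1 < t]) /=; apply; apply: open_nbhs_nbhs; split; first exact: open_gt.
    by rewrite /= /p d0 mul0r subr0 ltr1n.
  by apply: filterS p1 => y /ltW; exact: step_ge1.
- apply: (@rV_compact _ _ (fun i => `[a ord0 i - 2 * r, a ord0 i + 2 * r]%classic)).
  by move=> i; exact: segment_compact.
- move=> y yK; apply: eW; split => // i j; rewrite ord1.
  have := yK j; rewrite /= in_itv /= => yj.
  by rewrite /ball /= /ball_ ltr_norml /r in yj *; lra.
- move=> y yK /=; apply: step_le0; rewrite subr_le0.
  have [i /negP yi] : exists i, ~ (y ord0 i \in `[a ord0 i - 2 * r, a ord0 i + 2 * r]).
    by apply/existsNP => h; apply: yK => i; exact: h.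
  rewrite ler_pdivlMr ?exprn_gt0 //.
  have : (2 * r) ^+ 2 <= (y ord0 i - a ord0 i) ^+ 2.
    rewrite in_itv /= in yi.
    case: (leP (2 * r) (y ord0 i - a ord0 i)) => h; first by nra.
    have h' : y ord0 i - a ord0 i < - (2 * r).
      by rewrite ltNge; apply/negP => h'; apply: (negP yi); lra.
    by nra.
  move=> h; apply: le_trans (le_trans h _); first by have := sqr_ge0 r; nra.
  rewrite /d (bigD1 i) //= lerDl sumr_ge0 // => j _; exact: sqr_ge0.
Qed.

End Bump.

(** * Charts and smooth functions *)

(** The Hausdorff property is kept apart, in [separated]: for E^* x R it is proved
    with charts that are already known to be compatible. *)
Record smooth_atlas (R : realType) (M : atlasData R) : Prop := SmoothAtlas {
  atlas_cover : forall x : M, exists c, cdom c x ;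
  atlas_inj : forall (c : cidx M) (x y : M),
    cdom c x -> cdom c y -> cmap c x = cmap c y -> x = y ;
  atlas_open : forall c : cidx M, open_in (cdom c) ;
  atlas_compatible : forall (c : cidx M) j, smooth_on (cdom c) (coord c j)
}.

Definition separated (R : realType) (M : atlasData R) : Prop :=
  forall x y : M, x <> y ->
    exists U V : set M, [/\ open_in U, open_in V, U x, V y & U `&` V = set0].

Lemma manifold_atlas (R : realType) (M : atlasData R) :
  is_manifold M -> smooth_atlas M.
Proof. by case. Qed.

Lemma rep_chart (R : realType) (M : atlasData R) (c : cidx M) (f : M -> R) x :
  (forall x y : M, cdom c x -> cdom c y -> cmap c x = cmap c y -> x = y) ->
  cdom c x -> rep c f (cmap c x) = f x.
Proof.
move=> inj cx; rewrite /rep; case: xgetP => [_ -> [z /= [cz zx] <-]|].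
  by rewrite (inj _ _ cz cx zx).
by move=> /(_ (f x)) []; exists x.
Qed.

Section Charts.
Context {R : realType} {M : atlasData R}.
Hypothesis HM : smooth_atlas M.
Implicit Types (c d : cidx M) (U V W : set M) (f g : M -> R).

Lemma repE c f x : cdom c x -> rep c f (cmap c x) = f x.
Proof. exact/rep_chart/(atlas_inj HM). Qed.

Lemma chart_imgI c U V : chart_img c (U `&` V) = chart_img c U `&` chart_img c V.
Proof.
apply/seteqP; split=> [_ [x [[Ux Vx] cx] <-]|_ [[x [Ux cx] <-] [y [Vy cy] yx]]].
  by split; exists x.
by have e := atlas_inj HM cy cx yx; rewrite e in Vy; exists x.
Qed.

Lemma chart_img_in c U x : cdom c x -> chart_img c U (cmap c x) -> U x.
Proof. by move=> cx [y [Uy cy] /(atlas_inj HM cy cx) <-]. Qed.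

Lemma open_inI U V : open_in U -> open_in V -> open_in (U `&` V).
Proof. by move=> oU oV c; rewrite chart_imgI; exact: openI. Qed.

Lemma open_inT : open_in (@setT M).
Proof.
move=> c; suff -> : chart_img c setT = chart_img c (cdom c) by exact: (atlas_open HM).
by rewrite /chart_img setTI setIid.
Qed.

Lemma chart_preimg c d (O : set 'rV[R]_(dim M)) :
  chart_img d (cdom c `&` cmap c @^-1` O) =
  chart_img d (cdom c) `&` (fun y => \row_j rep d (coord c j) y) @^-1` O.
Proof.
have E x : cdom d x -> \row_j rep d (coord c j) (cmap d x) = cmap c x.
  by move=> dx; apply/rowP => j; rewrite mxE repE.
apply/seteqP; split=> [_ [x [[cx Ox] dx] <-]|_ [[x [cx dx] <-]]] /=.
  by split; [exists x|rewrite /= E].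
by rewrite E // => Ox; exists x.
Qed.

Lemma open_in_preimg c (O : set 'rV[R]_(dim M)) :
  open O -> open_in (cdom c `&` cmap c @^-1` O).
Proof.
move=> oO d; rewrite chart_preimg.
rewrite openE => y [dy Oy]; apply: filterI.
  by apply: open_nbhs_nbhs; split=> //; exact: (atlas_open HM).
have T : {for y, continuous (fun y => \row_j rep d (coord c j) y)}.
  apply/differentiable_continuous/differentiable_rV => j.
  have [+ _] := @atlas_compatible _ _ HM c j d 1%N; move=> /(_ y dy).
  by congr (differentiable _ _); apply/funext => z; rewrite mxE.
by apply: T; apply: open_nbhs_nbhs.
Qed.

Lemma smooth_onS U V f : V `<=` U -> smooth_on U f -> smooth_on V f.
Proof.
move=> VU fs c k; apply: Ck_sub (fs c k) => _ [x [Vx cx] <-].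
by exists x => //; split=> //; exact: VU.
Qed.

Lemma eq_smooth_on U f g : open_in U -> (forall x, U x -> f x = g x) ->
  smooth_on U f -> smooth_on U g.
Proof.
move=> oU fg fs c k; apply: eq_Ck (fs c k); first exact: oU.
by move=> _ [x [Ux cx] <-]; rewrite !repE //; exact: fg.
Qed.

Lemma smooth_on_local U f :
  (forall x, U x -> exists W, W x /\ smooth_on W f) -> smooth_on U f.
Proof.
move=> Uf c k; apply: Ck_local => _ [x [Ux cx] <-].
have [W [Wx Wf]] := Uf x Ux; exists (chart_img c W); split; last exact: Wf.
by exists x.
Qed.

Lemma smooth_on_cst U (a : R) : open_in U -> smooth_on U (fun=> a).
Proof.
move=> oU c k; apply: eq_Ck (Ck_cst k _ a); first exact: oU.
by move=> _ [x [_ cx] <-]; rewrite repE.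
Qed.

Lemma smooth_onD U f g : open_in U -> smooth_on U f -> smooth_on U g ->
  smooth_on U (fun x => f x + g x).
Proof.
move=> oU fs gs c k; apply: eq_Ck (CkD (oU c) (fs c k) (gs c k)); first exact: oU.
by move=> _ [x [_ cx] <-]; rewrite !repE.
Qed.

Lemma smooth_onM U f g : open_in U -> smooth_on U f -> smooth_on U g ->
  smooth_on U (fun x => f x * g x).
Proof.
move=> oU fs gs c k; apply: eq_Ck (CkM (oU c) (fs c k) (gs c k)); first exact: oU.
by move=> _ [x [_ cx] <-]; rewrite !repE.
Qed.

Lemma smooth_on_sum U m (F : 'I_m -> M -> R) : open_in U ->
  (forall i, smooth_on U (F i)) -> smooth_on U (fun x => \sum_i F i x).
Proof.
move=> oU Fs c k; apply: eq_Ck (Ck_sum (oU c) (fun i => Fs i c k)); first exact: oU.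
by move=> _ [x [_ cx] <-]; rewrite repE //; apply: eq_bigr => i _; rewrite repE.
Qed.

(** The transition to any other chart is smooth by compatibility, so it suffices to
    look at one chart. *)
Lemma smooth_on_chart c U f : open_in U -> U `<=` cdom c ->
  Cinfty (chart_img c U) (rep c f) -> smooth_on U f.
Proof.
move=> oU Uc fs d k.
have E x : cdom d x -> \row_j rep d (coord c j) (cmap d x) = cmap c x.
  by move=> dx; apply/rowP => j; rewrite mxE repE.
apply: (eq_Ck (oU d)) (Ck_comp (T := fun y => \row_j rep d (coord c j) y) (oU d) _ _ (fs k)).
- by move=> _ [x [Ux dx] <-] /=; rewrite E // !repE //; exact: Uc.
- by move=> _ [x [Ux dx] <-] /=; rewrite E //; exists x => //; split=> //; exact: Uc.
move=> j; apply: (eq_Ck (oU d)) (_ : Ck k _ (rep d (coord c j))).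
  by move=> y _; rewrite mxE.
by apply: Ck_sub (@atlas_compatible _ _ HM c j d k) => _ [x [Ux dx] <-]; exists x => //; split=> //; exact: Uc.
Qed.

Lemma smooth_on_comp c (phi : 'rV[R]_(dim M) -> R) :
  Cinfty setT phi -> smooth_on (cdom c) (phi \o cmap c).
Proof.
move=> ps; apply: (smooth_on_chart (c := c)) => // [|k]; first exact: (atlas_open HM).
have o := @atlas_open _ _ HM c c.
apply: (eq_Ck o) (Ck_sub (@subsetT _ _) (ps k)) => _ [x [_ cx] <-].
by rewrite repE.
Qed.

Lemma rep_differentiable U c f x : smooth_on U f -> U x -> cdom c x ->
  differentiable (rep c f) (cmap c x).
Proof. by move=> fs Ux cx; have [+ _] := fs c 1%N; apply; exists x. Qed.

Lemma smooth_on_derive U c f v : open_in U -> smooth_on U f ->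
  smooth_on (U `&` cdom c) (fun x => 'D_v (rep c f) (cmap c x)).
Proof.
move=> oU fs; apply: (smooth_on_chart (c := c)) => [||k].
- by apply: open_inI => //; exact: (atlas_open HM).
- by move=> x [].
have [_ /(_ v) fD] := fs c k.+1.
have o : open (chart_img c (U `&` cdom c)).
  by apply: open_inI => //; exact: (atlas_open HM).
apply: (eq_Ck o) (Ck_sub _ fD) => _ [x [[Ux _] cx] <-]; first by rewrite repE.
by exists x.
Qed.

End Charts.

(** * Smooth cut-off functions and extension of sections *)

Section CutOff.
Context {R : realType} {M : atlasData R}.
Hypotheses (HM : smooth_atlas M) (HS : separated M).

(** Otherwise the traces on K of the neighbourhoods of z cluster at a point of the
    compact set K, and the Hausdorff property makes that point equal to z. *)
Lemma chart_compact_closed (c : cidx M) (K : set 'rV[R]_(dim M)) (z : M) :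
  compact K -> K `<=` chart_img c setT -> ~ (cdom c z /\ K (cmap c z)) ->
  exists W : set M, [/\ open_in W, W z &
    forall y, W y -> ~ (cdom c y /\ K (cmap c y))].
Proof.
move=> cK Kc zK; apply: contrapT => noW.
pose KM : set M := [set y | cdom c y /\ K (cmap c y)].
pose D : set (set M) := [set W | open_in W /\ W z].
pose G := filter_from D (fun W => cmap c @` (W `&` KM)).
have DI W1 W2 : D W1 -> D W2 -> D (W1 `&` W2).
  by move=> [p1 z1] [p2 z2]; split; [exact: (open_inI HM)|split].
have fG : ProperFilter G.
  apply: filter_from_proper; last first.
    move=> W [oW Wz]; apply: contrapT => h; apply: noW; exists W; split=> // y Wy Ky.
    by apply: h; exists (cmap c y); exists y.
  apply: filter_from_filter; first by exists setT; split => //; exact: open_inT.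
  move=> W1 W2 D1 D2; exists (W1 `&` W2); first exact: DI.
  by move=> _ [y [[y1 y2] Ky] <-]; split; exists y.
have GK : G K.
  by exists setT; [split => //; exact: open_inT|move=> _ [y [_ [_ Ky]] <-]].
have [y [Ky Gy]] := cK G fG GK.
have [k [_ ck] ky] := Kc y Ky.
have kz : k <> z by move=> kz; apply: zK; rewrite -kz ky.
have [U1 [U2 [p1 p2 U1k U2z U12]]] := HS kz.
have GA : G (cmap c @` (U2 `&` KM)) by exists U2.
have By : nbhs y (chart_img c U1).
  by apply: open_nbhs_nbhs; split; [exact: p1|rewrite -ky; exists k].
have [w [[a [Ua [ca _]] <-] [b [Ub cb] ba]]] := Gy _ _ GA By.
have e := atlas_inj HM cb ca ba.
have : (U1 `&` U2) a by split=> //; rewrite -e.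
by rewrite U12.
Qed.

(** The bump function of a chart around x is extended by 0. This is smooth because
    the support, compact in the chart, is closed in M. *)
Lemma cutoff (U : set M) (x : M) : open_in U -> U x ->
  exists (chi : M -> R) (V : set M),
    [/\ smooth_fun chi, open_in V /\ V x, V `<=` U, forall z, V z -> chi z = 1 &
      forall z, ~ U z -> exists W, [/\ open_in W, W z & forall y, W y -> chi y = 0]].
Proof.
move=> oU Ux; have [c cx] := atlas_cover HM x.
have aU : chart_img c U (cmap c x) by exists x.
have [phi [K [ps p1 cK KU pK]]] := bump_rV (oU c) aU.
pose chi z := if `[< U z /\ cdom c z >] then phi (cmap c z) else 0.
have chi0 z : ~ (cdom c z /\ K (cmap c z)) -> chi z = 0.
  move=> zK; rewrite /chi; case: asboolP => // -[Uz cz].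
  by apply: pK => Kz; exact: zK.
have off z : ~ (cdom c z /\ K (cmap c z)) ->
    exists W, [/\ open_in W, W z & forall y, W y -> chi y = 0].
  move=> zK; have [|W [oW Wz WK]] := @chart_compact_closed c K z cK _ zK.
    by move=> y /KU [w [Uw cw] <-]; exists w.
  by exists W; split=> // y /WK; exact: chi0.
have oUc : open_in (U `&` cdom c) by apply: open_inI => //; exact: (atlas_open HM).
have : nbhs (cmap c x) [set y | phi y = 1] by exact: p1.
rewrite nbhsE => -[B [oB Ba] B1].
exists chi, (U `&` (cdom c `&` cmap c @^-1` B)); split.
- apply: smooth_on_local => z _.
  have [Uz|Uz] := pselect ((U `&` cdom c) z).
    exists (U `&` cdom c); split=> //.
    apply: (eq_smooth_on HM oUc (f := phi \o cmap c)) => [y Uy|].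
      by rewrite /chi asboolT.
    by apply: smooth_onS (@smooth_on_comp _ _ HM c _ ps) => y [].
  have [|W [oW Wz W0]] := off z.
    by move=> [cz Kz]; apply: Uz; split => //; exact: (chart_img_in HM cz) (KU _ Kz).
  exists W; split=> //; apply: (eq_smooth_on HM oW (f := fun=> 0)) => [y /W0 ->|] //.
  exact: smooth_on_cst.
- split; last by split.
  by apply: (open_inI HM) => //; exact: (open_in_preimg HM).
- by move=> z [].
- by move=> z [Uz [cz Bz]]; rewrite /chi asboolT //; exact: B1.
- move=> z Uz; apply: off => -[cz Kz]; apply: Uz.
  exact: (chart_img_in HM cz) (KU _ Kz).
Qed.

(** The bracket and the differential of forms are specified on global sections
    only. Multiplying the coefficients of a local section by a cut-off function lets
    them be extended by 0, without changing the section near x. The hypotheses on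
    the frames are separate assumptions so that they can be met by the frames of
    the prolongation. *)
Lemma extend_sect (A : bundleData M) (t : fidx A) (g : 'I_(rank A) -> M -> R)
    (x : M) : (forall t : fidx A, open_in (fdom t)) ->
  (forall (t t' : fidx A) (a : 'I_(rank A)),
    exists g : 'I_(rank A) -> M -> R,
      (forall b, smooth_on (fdom t `&` fdom t') (g b)) /\
      forall x, fdom t x -> fdom t' x ->
        frame t' a x = \sum_b g b x *: frame t b x) ->
  (forall a, smooth_on (fdom t) (g a)) -> fdom t x ->
  exists (s : sect A) (V : set M), [/\ smooth_sect s, open_in V /\ V x,
    V `<=` fdom t & forall z, V z -> s z = \sum_a g a z *: frame t a z].
Proof.
move=> ot comp gs tx; have [chi [V [cs oV Vt V1 c0]]] := cutoff (ot t) tx.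
pose h a z := if `[< fdom t z >] then chi z * g a z else 0.
have h1 a z : fdom t z -> h a z = chi z * g a z by move=> tz; rewrite /h asboolT.
exists (fun z => \sum_a h a z *: frame t a z), V; split=> //; last first.
  by move=> z Vz; apply: eq_bigr => a _; rewrite h1; [rewrite V1 ?mul1r|exact: Vt].
have hs a : smooth_fun (h a).
  apply: smooth_on_local => z _; have [tz|tz] := pselect (fdom t z).
    exists (fdom t); split=> //.
    apply: (eq_smooth_on HM (ot t) (f := fun z => chi z * g a z)).
      by move=> y ty; rewrite h1.
    by apply: smooth_onM => //; apply: smooth_onS cs.
  have [W [oW Wz W0]] := c0 z tz; exists W; split => //.
  apply: (eq_smooth_on HM oW (f := fun=> 0)); last exact: smooth_on_cst.
  by move=> y Wy; rewrite /h; case: asboolP => // _; rewrite W0 ?mul0r.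
move=> t'; pose G a b := sval (cid (comp t' t a)) b.
have [Gs Ge] : (forall a b, smooth_on (fdom t' `&` fdom t) (G a b)) /\
    (forall a z, fdom t' z -> fdom t z -> frame t a z = \sum_b G a b z *: frame t' b z).
  split=> [a b|a z tz t'z]; rewrite /G; case: cid => /= G0 []; first by move=> + _; exact.
  by move=> _; exact.
exists (fun b z => \sum_a (if `[< fdom t z >] then h a z * G a b z else 0)).
split=> [b|z t'z].
  apply: smooth_on_sum => // a; apply: smooth_on_local => z t'z.
  have [tz|tz] := pselect (fdom t z).
    have o : open_in (fdom t' `&` fdom t) by exact: (open_inI HM).
    exists (fdom t' `&` fdom t); split=> //.
    apply: (eq_smooth_on HM o (f := fun z => h a z * G a b z)).
      by move=> y [_ ty]; rewrite asboolT.
    by apply: smooth_onM => //; apply: smooth_onS (hs a).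
  have [W [oW Wz W0]] := c0 z tz; exists W; split => //.
  apply: (eq_smooth_on HM oW (f := fun=> 0)); last exact: smooth_on_cst.
  by move=> y Wy; case: asboolP => // ty; rewrite h1 // W0 ?mul0r.
have [tz|tz] := pselect (fdom t z); last first.
  rewrite [RHS]big1; last by move=> b _; rewrite big1 ?scale0r // => a _; rewrite asboolF.
  by rewrite big1 // => a _; rewrite /h asboolF // scale0r.
under [RHS]eq_bigr do rewrite scaler_suml.
rewrite exchange_big /=; apply: eq_bigr => a _.
rewrite (Ge a z t'z tz) scaler_sumr; apply: eq_bigr => b _.
by rewrite asboolT // scalerA.
Qed.

End CutOff.

(** * Tangent vectors *)

Section Tangents.
Context {R : realType} {M : atlasData R}.
Hypotheses (HM : smooth_atlas M) (HS : separated M).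
Implicit Types (c d : cidx M) (U V : set M) (f g : M -> R).

Lemma smooth_nearT x f : smooth_fun f -> smooth_near x f.
Proof. by move=> fs; exists setT; split => //; exact: (open_inT HM). Qed.

Lemma smooth_nearZD x (a : R) f g : smooth_near x f -> smooth_near x g ->
  smooth_near x (fun y => a * f y + g y).
Proof.
move=> [U [oU Ux Uf]] [V [oV Vx Vg]]; have o := open_inI HM oU oV.
exists (U `&` V); split=> //.
apply: smooth_onD => //; last by apply: smooth_onS Vg => y [].
apply: smooth_onM => //; first exact: smooth_on_cst.
by apply: smooth_onS Uf => y [].
Qed.

Lemma smooth_nearM x f g : smooth_near x f -> smooth_near x g ->
  smooth_near x (fun y => f y * g y).
Proof.
move=> [U [oU Ux Uf]] [V [oV Vx Vg]]; have o := open_inI HM oU oV.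
exists (U `&` V); split=> //.
apply: smooth_onM => //; last by apply: smooth_onS Vg => y [].
by apply: smooth_onS Uf => y [].
Qed.

Lemma eq_smooth_near x V f g : open_in V -> V x -> (forall y, V y -> f y = g y) ->
  smooth_near x f -> smooth_near x g.
Proof.
move=> oV Vx fg [U [oU Ux Uf]]; have o := open_inI HM oU oV.
exists (U `&` V); split=> //; apply: (eq_smooth_on HM o (f := f)).
  by move=> y [_]; exact: fg.
by apply: smooth_onS Uf => y [].
Qed.

Lemma smooth_near_coord x c j : cdom c x -> smooth_near x (coord c j).
Proof.
move=> cx; exists (cdom c); split => //; first exact: (atlas_open HM).
exact: (atlas_compatible HM).
Qed.

Lemma smooth_near_differentiable x c f : cdom c x -> smooth_near x f ->
  differentiable (rep c f) (cmap c x).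
Proof. by move=> cx [U [oU Ux Uf]]; exact: (rep_differentiable Uf). Qed.

Lemma near_chart U c x : open_in U -> U x -> cdom c x ->
  \forall y \near cmap c x, chart_img c U y.
Proof.
by move=> oU Ux cx; apply: open_nbhs_nbhs; split; [exact: oU|exists x].
Qed.

Lemma derive_rep_eq U c x f (F : 'rV[R]_(dim M) -> R) v :
  open_in U -> U x -> cdom c x ->
  (forall y, U y -> cdom c y -> f y = F (cmap c y)) ->
  'D_v (rep c f) (cmap c x) = 'D_v F (cmap c x).
Proof.
move=> oU Ux cx fF; apply: near_eq_derive.
apply: filterS (near_chart oU Ux cx) => _ [y [Uy cy] <-].
by rewrite (repE HM) // fF.
Qed.

(** The functional that defines [partial] is a derivation over the domain of the
    chart, by linearity of the derivative and the Leibniz rule. *)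
Lemma partialE c i x f : cdom c x -> partial c i x f =
  if `[< smooth_near x f >] then 'D_(delta_mx ord0 i) (rep c f) (cmap c x) else 0.
Proof.
move=> cx; rewrite /partial; set u := fun f : M -> R => _.
suff up : u \in derivation_pred x.
  by have -> : tfun (insubd 0 u : tangent x) = u := insubdK 0 up.
apply/asboolP; split; rewrite /u.
- by move=> h hN; rewrite asboolF.
- move=> a h k hs ks; rewrite !asboolT //; last exact: smooth_nearZD.
  have [hd kd] := (smooth_near_differentiable cx hs, smooth_near_differentiable cx ks).
  rewrite (@derive_rep_eq setT _ _ _ (a *: rep c h + rep c k)) //.
  + rewrite deriveD; last exact: diff_derivable.
      by rewrite deriveZ //; exact: diff_derivable.
    by apply: derivableZ; exact: diff_derivable.
  + exact: (open_inT HM).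
  + by move=> y _ cy; rewrite -![(_ + _) _]/(_ + _) /= -![(_ *: _) _]/(_ * _) !(repE HM).
- move=> h k hs ks; rewrite !asboolT //; last exact: smooth_nearM.
  have [hd kd] := (smooth_near_differentiable cx hs, smooth_near_differentiable cx ks).
  rewrite (@derive_rep_eq setT _ _ _ (rep c h * rep c k)) //.
  + rewrite deriveM ?(repE HM) //; exact: diff_derivable.
  + exact: (open_inT HM).
  + by move=> y _ cy; rewrite -![(_ * _) _]/(_ * _) !(repE HM).
Qed.

Lemma partial_near U c i x f (F : 'rV[R]_(dim M) -> R) :
  open_in U -> U x -> cdom c x -> smooth_near x f ->
  (forall y, U y -> cdom c y -> f y = F (cmap c y)) ->
  partial c i x f = 'D_(delta_mx ord0 i) F (cmap c x).
Proof.
move=> oU Ux cx fs fF; rewrite partialE // asboolT //.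
exact: derive_rep_eq fF.
Qed.

Lemma partial_coord c i j x : cdom c x -> partial c i x (coord c j) = (i == j)%:R.
Proof.
move=> cx; rewrite (partial_near (F := fun y => y ord0 j) _ (U := setT)) //.
- by rewrite derive_coord mxE eqxx eq_sym.
- exact: (open_inT HM).
- exact: smooth_near_coord.
Qed.

Lemma tangent_not_smooth x (v : tangent x) f : ~ smooth_near x f -> v f = 0.
Proof. by have /asboolP[+ _ _] := tangentP v; apply. Qed.

Lemma tangentZD x (v : tangent x) (a : R) f g :
  smooth_near x f -> smooth_near x g ->
  v (fun y => a * f y + g y) = a * v f + v g.
Proof. by have /asboolP[_ + _] := tangentP v; apply. Qed.

Lemma tangentM x (v : tangent x) f g :
  smooth_near x f -> smooth_near x g ->
  v (fun y => f y * g y) = f x * v g + g x * v f.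
Proof. by have /asboolP[_ _] := tangentP v; apply. Qed.

Lemma tangent_zero (x : M) (v : tangent x) : v (fun=> 0) = 0.
Proof.
have z : smooth_near x (fun=> 0 : R).
  by apply: smooth_nearT; apply: smooth_on_cst => //; exact: (open_inT HM).
have := tangentM v z z; rewrite !mul0r addr0 => h; rewrite -[RHS]h.
by congr (v _); apply/funext => y; rewrite mulr0.
Qed.

Lemma tangent_one (x : M) (v : tangent x) : v (fun=> 1) = 0.
Proof.
have z : smooth_near x (fun=> 1 : R).
  by apply: smooth_nearT; apply: smooth_on_cst => //; exact: (open_inT HM).
have := tangentM v z z; under [X in tfun v X]eq_fun do rewrite mulr1.
by rewrite !mul1r => /eqP; rewrite -subr_eq0 opprD addNKr oppr_eq0 => /eqP.
Qed.

Lemma tangentN (x : M) (v : tangent x) f : smooth_near x f ->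
  v (fun y => - f y) = - v f.
Proof.
move=> fs; have z : smooth_near x (fun=> 0 : R).
  by apply: smooth_nearT; apply: smooth_on_cst => //; exact: (open_inT HM).
have := tangentZD v (-1) fs z; rewrite tangent_zero addr0 mulN1r => <-.
by congr (v _); apply/funext => y; rewrite mulN1r addr0.
Qed.

(** A cut-off function reduces equality of germs to equality of functions. *)
Lemma tangent_germ x (v : tangent x) V f g : open_in V -> V x ->
  (forall y, V y -> f y = g y) -> v f = v g.
Proof.
move=> oV Vx fg; have [fs|fN] := pselect (smooth_near x f); last first.
  rewrite !tangent_not_smooth // => gs; apply: fN.
  by apply: eq_smooth_near gs => // y /fg.
have gs : smooth_near x g by exact: eq_smooth_near fs.
have [chi [W [cs [oW Wx] WV W1 c0]]] := cutoff HM HS oV Vx.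
have hs := smooth_nearZD (-1) gs fs.
have cn : smooth_near x chi by exact: smooth_nearT.
have := tangentM v cn hs.
have -> : (fun y => chi y * (-1 * g y + f y)) = fun=> 0.
  apply/funext => y; have [/fg ->|/c0[W' [_ W'y c0']]] := pselect (V y).
    by rewrite mulN1r addNr mulr0.
  by rewrite c0' // mul0r.
rewrite tangent_zero W1 // mul1r fg // mulN1r addNr mul0r addr0 tangentZD //.
by rewrite mulN1r => /esym/eqP; rewrite addrC subr_eq0 => /eqP.
Qed.

Lemma tfun_sum (x : M) m (a : 'I_m -> R) (v : 'I_m -> tangent x) f :
  tfun (\sum_j a j *: v j) f = \sum_j a j * v j f.
Proof.
elim/big_rec2: _ => [|j u w _ <-]; first by rewrite tfun0.
by rewrite -[RHS]/((a j *: tfun (v j) + tfun w) f) -tfun_linear.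
Qed.

(** Chain rule for the transition map, whose components are the coordinates of d
    read in the chart c. *)
Lemma partial_change c d i x : cdom c x -> cdom d x ->
  partial c i x = \sum_j (partial c i x (coord d j) : R) *: partial d j x.
Proof.
move=> cx dx; apply/val_inj/funext => f; rewrite /= tfun_sum.
have [fs|fN] := pselect (smooth_near x f); last first.
  rewrite tangent_not_smooth // big1 // => j _.
  by rewrite (tangent_not_smooth (partial d j x)) // mulr0.
pose T (y : 'rV[R]_(dim M)) := \row_j rep c (coord d j) y.
have Tx y : cdom c y -> T (cmap c y) = cmap d y.
  by move=> cy; apply/rowP => j; rewrite mxE (repE HM).
have oc := @atlas_open _ _ HM c; have od := @atlas_open _ _ HM d.
rewrite (partial_near (F := rep d f \o T) _ (U := cdom d)) //; last first.
  by move=> y dy cy; rewrite /= Tx // (repE HM).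
have Tj j : (fun z => T z ord0 j) = rep c (coord d j).
  by apply/funext => z; rewrite mxE.
have Td j : differentiable (rep c (coord d j)) (cmap c x).
  by apply: smooth_near_differentiable => //; exact: smooth_near_coord.
rewrite derive_comp_rV; last 2 first.
- by rewrite Tx //; exact: smooth_near_differentiable.
- by move=> j; rewrite Tj.
apply: eq_bigr => j _; rewrite Tj Tx // !partialE // !asboolT //; first by rewrite mulrC.
exact: smooth_near_coord.
Qed.

(** The coefficients of a combination of coordinate vectors are its values on the
    coordinates. *)
Definition in_span c x (v : tangent x) : Prop :=
  v = \sum_l (v (coord c l) : R) *: partial c l x.

Lemma in_span_sum c x m (a : 'I_m -> R) (v : 'I_m -> tangent x) :
  (forall i, in_span c (v i)) -> in_span c (\sum_i a i *: v i).
Proof.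
move=> vs; rewrite /in_span; under [RHS]eq_bigr do rewrite tfun_sum scaler_suml.
rewrite exchange_big /=; apply: eq_bigr => i _; rewrite {1}(vs i) scaler_sumr.
by apply: eq_bigr => l _; rewrite scalerA.
Qed.

Lemma in_span_partial c d i x : cdom c x -> cdom d x -> in_span d (partial c i x).
Proof. exact: partial_change. Qed.

Lemma in_span_change c d x (v : tangent x) :
  cdom c x -> cdom d x -> in_span c v -> in_span d v.
Proof.
by move=> cx dx ->; apply: in_span_sum => l; exact: in_span_partial.
Qed.

Lemma smooth_on_partial U c i f : open_in U -> smooth_on U f ->
  smooth_on (U `&` cdom c) (fun x => partial c i x f : R).
Proof.
move=> oU fs; have o : open_in (U `&` cdom c).
  by apply: (open_inI HM) => //; exact: (atlas_open HM).
apply: (eq_smooth_on HM o) (smooth_on_derive HM c (delta_mx ord0 i) oU fs) => x [Ux cx].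
by rewrite partialE // asboolT //; exists U.
Qed.

End Tangents.

(** * The manifold E^* x R *)

(** The remaining fields of a linear form are proofs. *)
Lemma scalar_ext (R : pzRingType) (V : lmodType R) (b b' : {scalar V}) :
  b =1 b' -> b = b'.
Proof.
case: b b' => [f [[fa] [fz]]] [g [[ga] [gz]]] /= fg.
have e : f = g by apply/funext.
subst g.
by rewrite (Prop_irrelevance fa ga) (Prop_irrelevance fz gz).
Qed.

Section Bases.
Context {R : realType} {V : lmodType R} {m : nat} {e : 'I_m -> V}.
Hypothesis He : is_basis e.

Definition bcoord (v : V) : 'rV[R]_m := sval (cid (He v)).

Lemma bcoordK v : v = \sum_i bcoord v ord0 i *: e i.
Proof. by rewrite /bcoord; case: cid => /= c []. Qed.

Lemma bcoord_uniq (c : 'rV[R]_m) v : v = \sum_i c ord0 i *: e i -> bcoord v = c.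
Proof. by move=> h; rewrite /bcoord; case: cid => /= c' [_]; apply. Qed.

Lemma bcoord_linear : linear bcoord.
Proof.
move=> a u v; apply: bcoord_uniq; rewrite [in LHS](bcoordK u) [in LHS](bcoordK v).
rewrite scaler_sumr -big_split; apply: eq_bigr => i _ /=.
by rewrite !mxE scalerDl scalerA.
Qed.

Lemma bcoord_basis i : bcoord (e i) = delta_mx ord0 i.
Proof.
apply: bcoord_uniq; rewrite (bigD1 i) //= mxE !eqxx scale1r big1 ?addr0 // => j ji.
by rewrite mxE (negPf ji) andbF scale0r.
Qed.

Lemma basis_neq0 i : e i <> 0.
Proof.
move=> e0; have := bcoord_basis i; have -> : bcoord (e i) = 0.
  by apply: bcoord_uniq; rewrite e0 big1 // => j _; rewrite mxE scale0r.
by move/rowP/(_ i); rewrite !mxE !eqxx => /esym/eqP; rewrite oner_eq0.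
Qed.

Lemma dual_basis (r : 'rV[R]_m) : exists b : {scalar V}, forall i, b (e i) = r ord0 i.
Proof.
pose f v : R := \sum_i bcoord v ord0 i * r ord0 i.
have fl : scalar f.
  move=> a u v; rewrite /f bcoord_linear mulr_sumr -big_split; apply: eq_bigr => i _.
  by rewrite !mxE mulrDl mulrA.
pose fL := GRing.isLinear.Build _ _ _ _ f fl.
pose F : {scalar V} := HB.pack f fL.
exists F => i; rewrite /= /f bcoord_basis (bigD1 i) //= mxE !eqxx mul1r.
by rewrite big1 ?addr0 // => j ji; rewrite mxE (negPf ji) andbF mul0r.
Qed.

End Bases.

Section DualAtlas.
Context {R : realType} {Q : atlasData R} {E : bundleData Q}.
Hypotheses (HQ : smooth_atlas Q) (QS : separated Q) (HE : is_vbundle E).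

Local Notation n := (dim Q).
Local Notation k := (rank E).
Local Notation pi := (@dualR_pi R Q E).

Definition base_idx (i : 'I_n) : 'I_(dim (dualR E)) := lshift 1 (lshift k i).
Definition fib_idx (a : 'I_k) : 'I_(dim (dualR E)) := lshift 1 (rshift n a).
Definition val_idx : 'I_(dim (dualR E)) := rshift (n + k) (@ord0 0).

Definition base_part (y : 'rV[R]_(dim (dualR E))) : 'rV[R]_n :=
  lsubmx (lsubmx (y : 'rV_(n + k + 1))).

Variant idx_spec : 'I_(dim (dualR E)) -> Prop :=
  | BaseIdx i : idx_spec (base_idx i)
  | FibIdx a : idx_spec (fib_idx a)
  | ValIdx : idx_spec val_idx.

Lemma idxP j : idx_spec j.
Proof.
change 'I_(n + k + 1) in j.
rewrite -[j]splitK; case: fintype.split => [l|l] /=; last first.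
  by rewrite (ord1 l); exact: ValIdx.
by rewrite -[l]splitK; case: fintype.split => [i|a] /=; [exact: BaseIdx|exact: FibIdx].
Qed.

Lemma base_partE y i : base_part y ord0 i = y ord0 (base_idx i).
Proof. by rewrite !mxE. Qed.

Lemma base_part_cmap ct (x : dualR E) : base_part (cmap ct x) = cmap ct.1 (pi x).
Proof. by rewrite /base_part /= !row_mxKl. Qed.

Lemma coord_base ct i : coord ct (base_idx i) = coord ct.1 i \o pi.
Proof. by apply/funext => x; rewrite /coord -base_partE base_part_cmap. Qed.

Lemma coord_fib ct a (x : dualR E) :
  coord ct (fib_idx a) x = projT2 x.1 (frame ct.2 a (pi x)).
Proof. by rewrite /coord /= row_mxEl row_mxEr mxE. Qed.

Lemma coord_val ct (x : dualR E) : coord ct val_idx x = x.2.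
Proof. by rewrite /coord /= row_mxEr mxE. Qed.

Lemma dualR_inj (ct : cidx (dualR E)) (x y : dualR E) :
  cdom ct x -> cdom ct y -> cmap ct x = cmap ct y -> x = y.
Proof.
move=> [cx tx] [cy ty] xy.
have e : pi x = pi y.
  by apply: (atlas_inj HQ cx cy); rewrite -!base_part_cmap xy.
have es : x.2 = y.2 by rewrite -(coord_val ct) /coord xy -(coord_val ct).
have ef a : projT2 x.1 (frame ct.2 a (pi x)) = projT2 y.1 (frame ct.2 a (pi y)).
  by rewrite -!coord_fib /coord xy.
move: x y e es ef {cx cy ty xy} tx => [[q b] s] [[q' b'] s'] /= e.
rewrite /dualR_pi /= in e *; case: q' / e b' => b' -> ef tx; congr (existT _ _ _, _).
apply: scalar_ext => v; have B := frame_basis HE tx.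
by rewrite (bcoordK B v) !linear_sum; apply: eq_bigr => a _; rewrite !linearZ /= ef.
Qed.

(** Every point of the model over the base chart is attained because a linear form
    can take arbitrary values on a basis. *)
Lemma chart_img_pi ct (U : set Q) :
  chart_img ct (pi @^-1` U) = base_part @^-1` chart_img ct.1 (U `&` fdom ct.2).
Proof.
apply/seteqP; split=> [_ [x [Ux [cx tx]] <-]|y].
  by rewrite /= base_part_cmap; exists (pi x).
move=> [q [[Uq tq] cq] qy].
have [b be] := dual_basis (frame_basis HE tq) (rsubmx (lsubmx (y : 'rV_(n + k + 1)))).
exists ((existT _ q b, y ord0 val_idx) : dualR E); first by split.
apply/rowP => j; case: (idxP j) => [i|a|].
- by rewrite -!base_partE base_part_cmap -qy.
- by rewrite -[LHS]/(coord ct (fib_idx a) _) coord_fib /= be !mxE.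
- by rewrite -[LHS]/(coord ct val_idx _) coord_val.
Qed.

Lemma base_part_continuous : continuous base_part.
Proof.
move=> y; apply/differentiable_continuous/differentiable_rV => i.
rewrite (_ : (fun z => _) = fun z : 'rV[R]_(dim (dualR E)) => z ord0 (base_idx i)); last first.
  by apply/funext => z; rewrite base_partE.
exact: differentiable_coord.
Qed.

Lemma open_in_pi (U : set Q) : open_in U -> open_in (pi @^-1` U).
Proof.
move=> oU ct; rewrite chart_img_pi; apply: open_comp.
  by move=> y _; exact: base_part_continuous.
rewrite (chart_imgI HQ); apply: openI; first exact: oU.
exact: (frame_open HE).
Qed.

Lemma smooth_on_pi (U : set Q) (f : Q -> R) : smooth_on U f -> open_in U ->
  smooth_on (pi @^-1` U) (f \o pi).
Proof.
move=> fs oU ct r; have o := @open_in_pi U oU ct.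
apply: (eq_Ck o) (Ck_comp (T := base_part) (F := rep ct.1 f) o _ _ (fs ct.1 r)).
- move=> _ [x [Ux cx] <-] /=; rewrite base_part_cmap (repE HQ); last by case: cx.
  by rewrite (rep_chart _ (@dualR_inj _)).
- move=> _ [x [Ux cx] <-] /=; rewrite base_part_cmap; exists (pi x) => //.
  by split => //; case: cx.
- move=> i; rewrite (_ : (fun z => _) = fun z : 'rV[R]_(dim (dualR E)) => z ord0 (base_idx i)).
    exact: Ck_coord.
  by apply/funext => z; rewrite base_partE.
Qed.

Lemma dualR_open (ct : cidx (dualR E)) : open_in (cdom ct).
Proof.
rewrite (_ : cdom ct = pi @^-1` (cdom ct.1 `&` fdom ct.2)) //.
apply: open_in_pi; apply: (open_inI HQ); first exact: (atlas_open HQ).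
exact: (frame_open HE).
Qed.

(** In the coordinate y_a = b (e_a) a change of frame of E acts linearly, with
    coefficients that are smooth functions on the base. *)
Lemma dualR_atlas : smooth_atlas (dualR E).
Proof.
split.
- move=> x; have [c cx] := atlas_cover HQ (pi x); have [t tx] := frames_cover HE (pi x).
  by exists (c, t).
- exact: dualR_inj.
- exact: dualR_open.
- move=> ct j; have o ct' := @dualR_open ct ct'.
  have oU : open_in (cdom ct.1 `&` fdom ct.2).
    by apply: (open_inI HQ); [exact: (atlas_open HQ)|exact: (frame_open HE)].
  case: (idxP j) => [i|a|].
  + rewrite coord_base; apply: (@smooth_on_pi (cdom ct.1 `&` fdom ct.2)) => //.
    by apply: smooth_onS (@atlas_compatible _ _ HQ ct.1 i) => y [].
  + move=> ct'; have [g [gs ge]] := frame_compatible HE ct'.2 ct.2 a.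
    have oV : open_in (fdom ct'.2 `&` fdom ct.2).
      by apply: (open_inI HQ); exact: (frame_open HE).
    move=> r; apply: (eq_Ck (o ct') (f := fun y : 'rV[R]_(dim (dualR E)) =>
        \sum_b rep ct' (g b \o pi) y * y ord0 (fib_idx b))).
      move=> _ [x [[cx tx] [c'x t'x]] <-].
      rewrite (rep_chart _ (@dualR_inj _)) // coord_fib (ge (pi x)) // linear_sum.
      apply: eq_bigr => b _; rewrite (rep_chart _ (@dualR_inj _)) //.
      by rewrite linearZ /= -(coord_fib ct').
    apply: Ck_sum => // b; apply: CkM => //; last exact: Ck_coord.
    apply: Ck_sub (smooth_on_pi (gs b) oV ct' r) => _ [x [[cx tx] [c'x t'x]] <-].
    by exists x.
  + move=> ct' r; apply: (eq_Ck (o ct')) (Ck_coord _ _ val_idx).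
    move=> _ [x [cx c'x] <-]; rewrite (rep_chart _ (@dualR_inj _)) // coord_val.
    by rewrite -(coord_val ct').
Qed.

(** Points over distinct points of Q are separated by preimages of open sets of Q;
    points of one fibre lie in a common chart and differ in some coordinate. *)
Lemma dualR_separated : separated (dualR E).
Proof.
move=> x y xy; have [e|ne] := pselect (pi x = pi y); last first.
  have [U [V [oU oV Ux Vy UV]]] := QS ne.
  exists (pi @^-1` U), (pi @^-1` V); split=> //; try exact: open_in_pi.
  by rewrite -preimage_setI UV preimage_set0.
have [ct cx] := atlas_cover dualR_atlas x.
have cy : cdom ct y.
  by change (cdom ct.1 (pi y) /\ fdom ct.2 (pi y)); rewrite -e; exact: cx.
have [j ne] : exists j, cmap ct x ord0 j != cmap ct y ord0 j.
  apply/existsP; apply: contra_notT xy; rewrite negb_exists => /forallP h.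
  by apply: (dualR_inj cx cy); apply/rowP => j; apply/eqP; have := h j; rewrite negbK.
wlog lt : x y xy e cx cy ne / cmap ct x ord0 j < cmap ct y ord0 j.
  move=> H; have [lt|gt|eq] := ltgtP (cmap ct x ord0 j) (cmap ct y ord0 j).
  - exact: (H x y).
  - have [||||||U [V [oU oV Uy Vx UV]]] := H y x => //; first by move=> h; apply: xy.
      by rewrite eq_sym.
    by exists V, U; split => //; rewrite setIC.
  - by rewrite eq eqxx in ne.
pose m := (cmap ct x ord0 j + cmap ct y ord0 j) / 2.
have cc : continuous (fun z : 'rV[R]_(dim (dualR E)) => z ord0 j) by exact: coord_continuous.
exists (cdom ct `&` cmap ct @^-1` [set z | z ord0 j < m]),
  (cdom ct `&` cmap ct @^-1` [set z | m < z ord0 j]); split.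
- apply: (open_in_preimg dualR_atlas).
  by apply: (@open_comp _ _ _ [set t | t < m]) => [z _|]; [exact: cc|exact: open_lt].
- apply: (open_in_preimg dualR_atlas).
  by apply: (@open_comp _ _ _ [set t | m < t]) => [z _|]; [exact: cc|exact: open_gt].
- by split => //; rewrite /= /m; lra.
- by split => //; rewrite /= /m; lra.
- apply/seteqP; split=> // z [[_ /= h1] [_ /= h2]].
  by have := lt_trans h1 h2; rewrite ltxx.
Qed.

End DualAtlas.

(** * The local frames of the prolongation *)

Section Anchor.
Context {R : realType} {Q : atlasData R} {E : bundleData Q}.
Hypotheses (HQ : smooth_atlas Q) (QS : separated Q) (HE : is_vbundle E).
Variable L : algebroid E.

Lemma anchorZD q (a : R) (u v : E q) :
  anchor L q (a *: u + v) = a *: anchor L q u + anchor L q v.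
Proof. by have [] := algebroidP L. Qed.

Lemma anchor0 q : anchor L q 0 = 0.
Proof. by have := anchorZD (-1) (0 : E q) 0; rewrite !scaleN1r oppr0 addr0 addNr. Qed.

Lemma anchor_sum q m (a : 'I_m -> R) (e : 'I_m -> E q) :
  anchor L q (\sum_i a i *: e i) = \sum_i a i *: anchor L q (e i).
Proof.
by elim/big_rec2: _ => [|i v u _ <-]; [exact: anchor0|rewrite anchorZD].
Qed.

(** Only smooth sections are known to have an anchor that is a combination of
    the coordinate vectors, so a frame vector has to be extended first. *)
Lemma anchor_frame_coef (t : fidx E) (c : cidx Q) a q : fdom t q -> cdom c q ->
  exists (g : 'I_(dim Q) -> Q -> R) (V : set Q), [/\ open_in V, V q,
    forall i, smooth_on V (g i) &
    forall z, V z -> anchor L z (frame t a z) = \sum_i g i z *: partial c i z /\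
      forall i, anchor L z (frame t a z) (coord c i) = g i z].
Proof.
move=> tq cq.
have [||s [V [ss [oV Vq] Vt Ve]]] :=
    @extend_sect _ _ HQ QS E t (fun b _ => (b == a)%:R) q (@frame_open _ _ _ HE) (frame_compatible HE).
- by move=> b; apply: smooth_on_cst => //; exact: (frame_open HE).
- by [].
have Ve' z : V z -> s z = frame t a z.
  move=> Vz; rewrite Ve // (bigD1 a) //= eqxx scale1r big1 ?addr0 // => b ba.
  by rewrite (negPf ba) scale0r.
have [_ asm _ _ _ _ _] := algebroidP L.
have [g [gs ge]] := asm s ss c.
have oc : open_in (cdom c) by exact: (atlas_open HQ).
exists g, (V `&` cdom c); split.
- exact: (open_inI HQ).
- by split.
- by move=> i; apply: smooth_onS (gs i) => z [].
- move=> z [Vz cz]; rewrite -Ve' // ge //; split=> // i; rewrite tfun_sum.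
  rewrite (bigD1 i) //= (partial_coord HQ) // eqxx mulr1 big1 ?addr0 // => j ji.
  by rewrite (partial_coord HQ) // (negPf ji) mulr0.
Qed.

Lemma anchor_frame (t : fidx E) (c : cidx Q) a q : fdom t q -> cdom c q ->
  anchor L q (frame t a q) =
    \sum_i (anchor L q (frame t a q) (coord c i) : R) *: partial c i q.
Proof.
move=> tq cq; have [g [V [_ Vq _ Ve]]] := anchor_frame_coef a tq cq.
by have [e ge] := Ve q Vq; rewrite {1}e; apply: eq_bigr => i _; rewrite ge.
Qed.

Lemma smooth_on_anchor_frame (t : fidx E) (c : cidx Q) a i :
  smooth_on (cdom c `&` fdom t) (fun q => anchor L q (frame t a q) (coord c i) : R).
Proof.
apply: smooth_on_local => q [cq tq].
have [g [V [oV Vq gs Ve]]] := anchor_frame_coef a tq cq.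
exists V; split=> //; apply: (eq_smooth_on HQ oV) (gs i) => z Vz.
by have [_ ->] := Ve z Vz.
Qed.

End Anchor.

Section Frames.
Context {R : realType} {Q : atlasData R} {E : bundleData Q}.
Hypotheses (HQ : smooth_atlas Q) (QS : separated Q) (HE : is_vbundle E).
Variable L : algebroid E.

Local Notation k := (rank E).
Local Notation D := (dualR E).
Local Notation pi := (@dualR_pi R Q E).
Implicit Types (ct : cidx D) (x : D).

Let HD : smooth_atlas D := dualR_atlas HQ HE.
Let DS : separated D := dualR_separated HQ QS HE.

Lemma smooth_near_pi x f : smooth_near (pi x) f -> smooth_near x (f \o pi).
Proof.
move=> [U [oU Ux Uf]]; exists (pi @^-1` U); split=> //; first exact: open_in_pi.
exact: smooth_on_pi.
Qed.

Definition base_of (j : 'I_(dim D)) : 'rV[R]_(dim Q) :=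
  base_part (delta_mx ord0 j : 'rV[R]_(dim D)).

(** In charts the projection is the linear map [base_part], so lines are mapped to
    lines. *)
Lemma push_pi_partial ct x j f : cdom ct x ->
  push pi (pi x) (partial ct j x) f =
  if `[< smooth_near (pi x) f >] then 'D_(base_of j) (rep ct.1 f) (cmap ct.1 (pi x))
  else 0.
Proof.
move=> cx; rewrite /push; case: asboolP => // fs.
have [U [oU Ux Uf]] := fs.
rewrite (@partial_near _ _ HD (pi @^-1` U) ct j x _ (rep ct.1 f \o base_part)) //.
- rewrite (@derive_affine _ _ _ _ _ _ _ (base_of j)); first by rewrite base_part_cmap.
  by move=> t; rewrite /base_of /base_part !linearP.
- exact: open_in_pi.
- exact: smooth_near_pi.
- by move=> y Uy [cy ty]; rewrite /= base_part_cmap (repE HQ).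
Qed.

Lemma push_pi_base ct x i : cdom ct x ->
  push pi (pi x) (partial ct (base_idx i) x) = tfun (partial ct.1 i (pi x)).
Proof.
move=> cx; apply/funext => f; rewrite push_pi_partial // (partialE HQ); last by case: cx.
rewrite (_ : base_of _ = delta_mx ord0 i) //.
by apply/rowP => l; rewrite base_partE !mxE (inj_eq (@lshift_inj _ _)) (inj_eq (@lshift_inj _ _)).
Qed.

Lemma push_pi_fib ct x a : cdom ct x ->
  push pi (pi x) (partial ct (fib_idx a) x) = 0.
Proof.
move=> cx; apply/funext => f; rewrite push_pi_partial //.
rewrite (_ : base_of _ = 0) ?derive0 ?if_same //.
by apply/rowP => l; rewrite base_partE !mxE (inj_eq (@lshift_inj _ _)) eq_lrshift.
Qed.

Lemma push_pi_val ct x : cdom ct x ->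
  push pi (pi x) (partial ct val_idx x) = 0.
Proof.
move=> cx; apply/funext => f; rewrite push_pi_partial //.
rewrite (_ : base_of _ = 0) ?derive0 ?if_same //.
by apply/rowP => l; rewrite base_partE !mxE eq_lrshift.
Qed.

Lemma push_sum (M N : atlasData R) (F : M -> N) y (x : M) m (a : 'I_m -> R) (v : 'I_m -> tangent x) :
  push F y (tfun (\sum_j a j *: v j)) = \sum_j a j *: push F y (tfun (v j)).
Proof.
elim/big_rec2: _ => [|j u w _ <-]; first by rewrite tfun0 push0.
by rewrite tfun_linear push_linear.
Qed.

Lemma tfun_sumE (M : atlasData R) (x : M) m (a : 'I_m -> R) (v : 'I_m -> tangent x) :
  tfun (\sum_j a j *: v j) = \sum_j a j *: tfun (v j).
Proof.
elim/big_rec2: _ => [|j u w _ <-]; first exact: tfun0.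
by rewrite tfun_linear.
Qed.

Lemma prol_val_insub x (w : E (pi x) * tangent x) :
  tfun (anchor L (pi x) w.1) = push pi (pi x) (tfun w.2) ->
  prol_val (insubd 0 w : prol_fib L x) = w.
Proof. by move=> h; apply: insubdK; apply/asboolP. Qed.

(** The pair that defines [prolX] is in the fibre because rho (e_a) is the
    combination of the coordinate vectors of Q with coefficients rho (e_a) (q^i). *)
Lemma prolX_val ct a x : cdom ct x -> prol_val (prolX L ct a x) =
  (frame ct.2 a (pi x),
   \sum_i (anchor L (pi x) (frame ct.2 a (pi x)) (coord ct.1 i) : R) *:
      partial ct (base_idx i) x).
Proof.
move=> cx; have [cq tq] := cx; apply: prol_val_insub => /=.
rewrite push_sum {1}(anchor_frame HQ QS HE L a tq cq) tfun_sumE; apply: eq_bigr => i _.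
by rewrite push_pi_base.
Qed.

Lemma prolV_val ct a x : cdom ct x ->
  prol_val (prolV L ct a x) = (0, partial ct (fib_idx a) x).
Proof.
by move=> cx; apply: prol_val_insub => /=; rewrite anchor0 tfun0 push_pi_fib.
Qed.

Lemma prolVs_val ct x : cdom ct x ->
  prol_val (prolVs L ct x) = (0, partial ct val_idx x).
Proof.
by move=> cx; apply: prol_val_insub => /=; rewrite anchor0 tfun0 push_pi_val.
Qed.

End Frames.
Section ProlongationFrames.
Context {R : realType} {Q : atlasData R} {E : bundleData Q}.
Hypotheses (HQ : smooth_atlas Q) (QS : separated Q) (HE : is_vbundle E).
Variable L : algebroid E.

Local Notation k := (rank E).
Local Notation D := (dualR E).
Local Notation pi := (@dualR_pi R Q E).
Local Notation A := (prolongation L).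
Local Notation vidx := (@val_idx R Q E).
Implicit Types (ct : cidx D) (x : D).

Let HD : smooth_atlas D := dualR_atlas HQ HE.
Let DS : separated D := dualR_separated HQ QS HE.

Definition pr2 x (w : prol_fib L x) : tangent x := (prol_val w).2.

Lemma pr1ZD x (a : R) (u v : prol_fib L x) : pr1 (a *: u + v) = a *: pr1 u + pr1 v.
Proof. by []. Qed.

Lemma pr2ZD x (a : R) (u v : prol_fib L x) : pr2 (a *: u + v) = a *: pr2 u + pr2 v.
Proof. by []. Qed.

Lemma pr1D x (u v : prol_fib L x) : pr1 (u + v) = pr1 u + pr1 v.
Proof. by []. Qed.

Lemma pr2D x (u v : prol_fib L x) : pr2 (u + v) = pr2 u + pr2 v.
Proof. by []. Qed.

Lemma pr1Z x (a : R) (u : prol_fib L x) : pr1 (a *: u) = a *: pr1 u.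
Proof. by []. Qed.

Lemma pr2Z x (a : R) (u : prol_fib L x) : pr2 (a *: u) = a *: pr2 u.
Proof. by []. Qed.

Lemma pr1_sum x m (a : 'I_m -> R) (w : 'I_m -> prol_fib L x) :
  pr1 (\sum_i a i *: w i) = \sum_i a i *: pr1 (w i).
Proof. by elim/big_rec2: _ => [//|i u v _ <-]; rewrite pr1ZD. Qed.

Lemma pr2_sum x m (a : 'I_m -> R) (w : 'I_m -> prol_fib L x) :
  pr2 (\sum_i a i *: w i) = \sum_i a i *: pr2 (w i).
Proof. by elim/big_rec2: _ => [//|i u v _ <-]; rewrite pr2ZD. Qed.

Lemma prol_ext x (u v : prol_fib L x) : pr1 u = pr1 v -> pr2 u = pr2 v -> u = v.
Proof.
move=> e1 e2; apply: val_inj; move: e1 e2; rewrite /pr1 /pr2 /=.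
by case: (prol_val u) => ? ?; case: (prol_val v) => ? ? /= -> ->.
Qed.

Definition idxX (a : 'I_k) : 'I_(rank A) := lshift 1 (lshift k a).
Definition idxV (a : 'I_k) : 'I_(rank A) := lshift 1 (rshift k a).
Definition idxVs : 'I_(rank A) := rshift (k + k) (@ord0 0).

Lemma frame_idxX ct a x : frame (b := A) ct (idxX a) x = prolX L ct a x.
Proof.
by rewrite /= -[idxX a]/(unsplit (inl (unsplit (inl a)))) !unsplitK.
Qed.

Lemma frame_idxV ct a x : frame (b := A) ct (idxV a) x = prolV L ct a x.
Proof.
by rewrite /= -[idxV a]/(unsplit (inl (unsplit (inr a)))) !unsplitK.
Qed.

Lemma frame_idxVs ct x : frame (b := A) ct idxVs x = prolVs L ct x.
Proof. by rewrite /= -[idxVs]/(unsplit (inr ord0)) !unsplitK. Qed.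

Variant frame_spec : 'I_(rank A) -> Prop :=
  | FrameX a : frame_spec (idxX a)
  | FrameV a : frame_spec (idxV a)
  | FrameVs : frame_spec idxVs.

Lemma frameP r : frame_spec r.
Proof.
change 'I_(k + k + 1) in r.
rewrite -[r]splitK; case: fintype.split => [l|l] /=; last first.
  by rewrite (ord1 l); exact: FrameVs.
by rewrite -[l]splitK; case: fintype.split => [i|a] /=; [exact: FrameX|exact: FrameV].
Qed.

Lemma sum_frames (V : nmodType) (F : 'I_(rank A) -> V) :
  \sum_r F r = \sum_a F (idxX a) + \sum_a F (idxV a) + F idxVs.
Proof.
by rewrite (@big_split_ord _ _ _ (k + k) 1) (@big_split_ord _ _ _ k k) big_ord1.
Qed.

Lemma sum_idx (V : nmodType) (F : 'I_(dim D) -> V) :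
  \sum_j F j = \sum_i F (base_idx i) + \sum_a F (fib_idx a) + F vidx.
Proof.
by rewrite (@big_split_ord _ _ _ (dim Q + k) 1) (@big_split_ord _ _ _ (dim Q) k) big_ord1.
Qed.

Lemma pr2_base ct x (w : prol_fib L x) i : cdom ct x ->
  pr2 w (coord ct (base_idx i)) = anchor L (pi x) (pr1 w) (coord ct.1 i).
Proof.
move=> [cx tx]; have /asboolP -> := prol_valP w.
rewrite /push asboolT -?coord_base //; exact: smooth_near_coord.
Qed.

(** The coefficients of a vector on the X-part of the frame are those of its
    component in E; the base coordinates of its tangent component are then
    forced by the anchor. *)
Lemma prol_decomp ct x (w : prol_fib L x) (kap : 'I_k -> R) : cdom ct x ->
  pr1 w = \sum_a kap a *: frame ct.2 a (pi x) ->
  in_span ct (pr2 w) ->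
  w = \sum_a kap a *: prolX L ct a x +
      \sum_a (pr2 w (coord ct (fib_idx a)) : R) *: prolV L ct a x +
      (pr2 w (coord ct vidx) : R) *: prolVs L ct x.
Proof.
move=> cx w1 w2; have [cq tq] := cx.
pose W := \sum_a (pr2 w (coord ct (fib_idx a)) : R) *: prolV L ct a x.
pose Vs := (pr2 w (coord ct vidx) : R) *: prolVs L ct x.
have v1 : pr1 (W + Vs) = 0.
  rewrite pr1D pr1Z [pr1 (prolVs _ _ _)]/pr1 prolVs_val // scaler0 addr0.
  by rewrite pr1_sum big1 // => a _; rewrite /pr1 prolV_val // scaler0.
have v2 : pr2 (W + Vs) = \sum_a (pr2 w (coord ct (fib_idx a)) : R) *: partial ct (fib_idx a) x
   + (pr2 w (coord ct vidx) : R) *: partial ct vidx x.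
  rewrite pr2D pr2Z [pr2 (prolVs _ _ _)]/pr2 prolVs_val // pr2_sum; congr (_ + _).
  by apply: eq_bigr => a _; rewrite [pr2 (prolV _ _ _ _)]/pr2 prolV_val.
rewrite -addrA -/W -/Vs; apply: prol_ext.
  rewrite pr1D v1 addr0 pr1_sum w1; apply: eq_bigr => a _.
  by rewrite /pr1 prolX_val.
rewrite pr2D v2 pr2_sum {1}w2 sum_idx -addrA; congr (_ + _).
under [RHS]eq_bigr => a _ do rewrite [pr2 (prolX _ _ _ _)]/pr2 prolX_val // scaler_sumr.
rewrite exchange_big /=; apply: eq_bigr => i _.
rewrite pr2_base // w1 anchor_sum tfun_sum scaler_suml; apply: eq_bigr => a _.
by rewrite scalerA.
Qed.

Definition frame_vec ct (r : 'I_(rank A)) (j : 'I_(dim D)) (x : D) : R :=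
  pr2 (frame (b := A) ct r x) (coord ct j).

Lemma frame_in_span ct r x : cdom ct x -> in_span ct (pr2 (frame (b := A) ct r x)).
Proof.
move=> cx; case: (frameP r) => [a|a|].
- rewrite frame_idxX /pr2 prolX_val //; apply: in_span_sum => i.
  exact: in_span_partial.
- by rewrite frame_idxV /pr2 prolV_val //; exact: in_span_partial.
- by rewrite frame_idxVs /pr2 prolVs_val //; exact: in_span_partial.
Qed.

Lemma dualR_dom_open ct : open_in (cdom ct.1 `&` fdom ct.2).
Proof.
by apply: (open_inI HQ); [exact: (atlas_open HQ)|exact: (frame_open HE)].
Qed.

Lemma smooth_on_frame_vec ct r j : smooth_on (cdom ct) (frame_vec ct r j).
Proof.
have o : open_in (cdom ct) by exact: (atlas_open HD).
case: (frameP r) => [a|a|].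
- apply: (eq_smooth_on HD o (f := fun x => \sum_i
    anchor L (pi x) (frame ct.2 a (pi x)) (coord ct.1 i) * (base_idx i == j)%:R)).
    move=> x cx; rewrite /frame_vec frame_idxX /pr2 prolX_val // tfun_sum.
    by apply: eq_bigr => i _; rewrite partial_coord.
  apply: smooth_on_sum => // i; apply: smooth_onM => //; last exact: smooth_on_cst.
  apply: (smooth_on_pi HQ HE (@smooth_on_anchor_frame _ _ _ HQ QS HE L ct.2 ct.1 a i)).
  exact: dualR_dom_open.
- apply: (eq_smooth_on HD o (f := fun x => (fib_idx a == j)%:R)).
    by move=> x cx; rewrite /frame_vec frame_idxV /pr2 prolV_val // partial_coord.
  exact: smooth_on_cst.
- apply: (eq_smooth_on HD o (f := fun x => (vidx == j)%:R)).
    by move=> x cx; rewrite /frame_vec frame_idxVs /pr2 prolVs_val // partial_coord.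
  exact: smooth_on_cst.
Qed.

Lemma frame_pr1 ct ct' r : exists kap : 'I_k -> Q -> R,
  (forall b, smooth_on (fdom ct'.2 `&` fdom ct.2) (kap b)) /\
  forall x, cdom ct x -> cdom ct' x ->
    pr1 (frame (b := A) ct r x) = \sum_b kap b (pi x) *: frame ct'.2 b (pi x).
Proof.
have o : open_in (fdom ct'.2 `&` fdom ct.2).
  by apply: (open_inI HQ); exact: (frame_open HE).
case: (frameP r) => [a|a|].
- have [g [gs ge]] := frame_compatible HE ct'.2 ct.2 a; exists g; split=> // x cx c'x.
  rewrite frame_idxX /pr1 prolX_val //=; apply: ge; by [case: c'x|case: cx].
- exists (fun _ _ => 0); split=> [b|x cx _]; first exact: smooth_on_cst.
  by rewrite frame_idxV /pr1 prolV_val //= big1 // => b _; rewrite scale0r.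
- exists (fun _ _ => 0); split=> [b|x cx _]; first exact: smooth_on_cst.
  by rewrite frame_idxVs /pr1 prolVs_val //= big1 // => b _; rewrite scale0r.
Qed.

(** By [prol_decomp] the coefficients are those of the change of frame of E and the
    derivatives, along the old frame, of the new coordinates. *)
Lemma prolongation_compatible ct ct' r : exists g : 'I_(rank A) -> D -> R,
  (forall b, smooth_on (cdom ct `&` cdom ct') (g b)) /\
  forall x, cdom ct x -> cdom ct' x ->
    frame (b := A) ct' r x = \sum_b g b x *: frame (b := A) ct b x.
Proof.
have oc ct0 : open_in (cdom ct0) by exact: (atlas_open HD).
have o : open_in (cdom ct `&` cdom ct') by exact: (open_inI HD).
have [kap [ks ke]] := frame_pr1 ct' ct r.
pose w x := frame (b := A) ct' r x.
pose g (b : 'I_(rank A)) x : R := match fintype.split (b : 'I_(k + k + 1)) with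
  | inl b' => match fintype.split b' with
              | inl a => kap a (pi x)
              | inr a => pr2 (w x) (coord ct (fib_idx a))
              end
  | inr _ => pr2 (w x) (coord ct vidx)
  end.
have gX a : g (idxX a) = kap a \o pi.
  by apply/funext => x; rewrite /g -[idxX a]/(unsplit (inl (unsplit (inl a)))) !unsplitK.
have gV a : g (idxV a) = fun x => pr2 (w x) (coord ct (fib_idx a)).
  by apply/funext => x; rewrite /g -[idxV a]/(unsplit (inl (unsplit (inr a)))) !unsplitK.
have gVs : g idxVs = fun x => pr2 (w x) (coord ct vidx).
  by apply/funext => x; rewrite /g -[idxVs]/(unsplit (inr ord0)) !unsplitK.
have ws l : smooth_on (cdom ct `&` cdom ct') (fun x => pr2 (w x) (coord ct l) : R).
  apply: (eq_smooth_on HD o (f := fun x =>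
      \sum_j frame_vec ct' r j x * partial ct' j x (coord ct l))).
    by move=> x [cx c'x]; rewrite [in RHS](frame_in_span r c'x) tfun_sum.
  apply: smooth_on_sum => // j; apply: smooth_onM => //.
    by apply: smooth_onS (@smooth_on_frame_vec ct' r j) => x [].
  by apply: smooth_on_partial => //; exact: (atlas_compatible HD).
exists g; split=> [b|x cx c'x].
- case: (frameP b) => [a|a|]; rewrite ?gX ?gV ?gVs //.
  have ok : open_in (fdom ct.2 `&` fdom ct'.2).
    by apply: (open_inI HQ); exact: (frame_open HE).
  by apply: smooth_onS (smooth_on_pi HQ HE (ks a) ok) => x [[_ tx] [_ t'x]].
- rewrite sum_frames gVs frame_idxVs.
  under eq_bigr do rewrite gX frame_idxX.
  under [X in _ + X + _]eq_bigr do rewrite gV frame_idxV.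
  apply: prol_decomp => //; first exact: ke.
  by apply: (in_span_change HD c'x cx); exact: frame_in_span.
Qed.

Lemma contact_eta_X ct a x : cdom ct x ->
  contact_eta (args [:: prolX L ct a x]) = - coord ct (fib_idx a) x.
Proof.
move=> cx; rewrite /contact_eta /args /= prolX_val // /pr1 prolX_val // coord_fib.
rewrite tfun_sum big1 ?sub0r // => i _.
rewrite (_ : (fun _ => _) = coord ct vidx); last by apply/funext => y; rewrite coord_val.
by rewrite (partial_coord HD) // eq_lrshift mulr0.
Qed.

Lemma contact_eta_V ct a x : cdom ct x ->
  contact_eta (args [:: prolV L ct a x]) = 0.
Proof.
move=> cx; rewrite /contact_eta /args /= prolV_val // /pr1 prolV_val // linear0 subr0.
rewrite (_ : (fun _ => _) = coord ct vidx); last by apply/funext => y; rewrite coord_val.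
by rewrite (partial_coord HD) // eq_lrshift.
Qed.

Lemma contact_eta_Vs ct x : cdom ct x ->
  contact_eta (args [:: prolVs L ct x]) = 1.
Proof.
move=> cx; rewrite /contact_eta /args /= prolVs_val // /pr1 prolVs_val // linear0 subr0.
rewrite (_ : (fun _ => _) = coord ct vidx); last by apply/funext => y; rewrite coord_val.
by rewrite (partial_coord HD) // eqxx.
Qed.

(** The values of the bracket on the frame are given through global sections that
    agree with it on an open set. *)
Lemma extend_frame ct r x : cdom ct x ->
  exists (s : sect A) (V : set D), [/\ smooth_sect s, open_in V /\ V x,
    V `<=` cdom ct & forall z, V z -> s z = frame (b := A) ct r z].
Proof.
move=> cx; have oc ct0 : open_in (cdom ct0) by exact: (atlas_open HD).
have [||s [V [ss oV Vc Ve]]] :=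
    @extend_sect _ _ HD DS A ct (fun b _ => (b == r)%:R) x oc prolongation_compatible.
- by move=> b; exact: (smooth_on_cst HD _ (oc ct)).
- exact: cx.
exists s, V; split=> // z Vz; rewrite Ve // (bigD1 r) //= eqxx scale1r big1 ?addr0 // => b br.
by rewrite (negPf br) scale0r.
Qed.

End ProlongationFrames.

(** * Forms of degree one and two *)

Section TwoForms.
Context {R : realType} {M : atlasData R} {A : bundleData M}.
Variable nu : forall x : M, ('I_2 -> A x) -> R.
Hypothesis Hnu : is_form nu.

Lemma args2E (V : lmodType R) (f : 'I_2 -> V) u v :
  f ord0 = u -> f ord_max = v -> f = args [:: u; v].
Proof.
move=> fu fv; apply/funext => -[[|[|//]] h]; rewrite /args /=.
  by rewrite -fu; congr f; exact: val_inj.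
by rewrite -fv; congr f; exact: val_inj.
Qed.

Lemma args1E (V : lmodType R) (f : 'I_1 -> V) u : f ord0 = u -> f = args [:: u].
Proof. by move=> fu; apply/funext => p; rewrite (ord1 p) fu. Qed.

Lemma form2ZDl x c u v w :
  nu (args [:: c *: u + v; w]) = c * nu (args [:: u; w]) + nu (x := x) (args [:: v; w]).
Proof.
have := form_linear Hnu (args [:: u; w]) ord0 c u v.
have e z : (fun j => if j == ord0 then z else args [:: u; w] j) = args [:: z; w] :> ('I_2 -> A x).
  exact: args2E.
by rewrite !e.
Qed.

Lemma form2ZDr x c u v w :
  nu (args [:: w; c *: u + v]) = c * nu (args [:: w; u]) + nu (x := x) (args [:: w; v]).
Proof.
have := form_linear Hnu (args [:: w; u]) ord_max c u v.
have e z : (fun j => if j == ord_max then z else args [:: w; u] j) = args [:: w; z] :> ('I_2 -> A x).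
  exact: args2E.
by rewrite !e.
Qed.

Lemma form2_diag x u : nu (x := x) (args [:: u; u]) = 0.
Proof. exact: (form_alternating Hnu (i := ord0) (j := ord_max)). Qed.

Lemma form2_anti x u v : nu (x := x) (args [:: u; v]) = - nu (args [:: v; u]).
Proof.
have := form2_diag (1 *: u + v).
rewrite form2ZDl !form2ZDr !form2_diag !mul1r add0r addr0 => /eqP.
by rewrite addr_eq0 => /eqP.
Qed.

Lemma form2_0l x w : nu (x := x) (args [:: 0; w]) = 0.
Proof.
by have := form2ZDl (-1) (0 : A x) 0 w; rewrite scaleN1r oppr0 addr0 mulN1r addNr.
Qed.

Lemma form2_suml x m (a : 'I_m -> R) (u : 'I_m -> A x) w :
  nu (args [:: \sum_i a i *: u i; w]) = \sum_i a i * nu (args [:: u i; w]).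
Proof. by elim/big_rec2: _ => [|i c v _ <-]; rewrite ?form2_0l ?form2ZDl. Qed.

Lemma form2_sumr x m (a : 'I_m -> R) (u : 'I_m -> A x) w :
  nu (args [:: w; \sum_i a i *: u i]) = \sum_i a i * nu (args [:: w; u i]).
Proof.
rewrite form2_anti form2_suml -sumrN; apply: eq_bigr => i _.
by rewrite -mulrN -form2_anti.
Qed.

End TwoForms.

Lemma form1ZD (R : realType) (M : atlasData R) (A : bundleData M)
    (mu : forall x : M, ('I_1 -> A x) -> R) x c (u v : A x) : is_form mu ->
  mu x (args [:: c *: u + v]) = c * mu x (args [:: u]) + mu x (args [:: v]).
Proof.
move=> Hmu; have := form_linear Hmu (args [:: u]) ord0 c u v.
have e z : (fun j => if j == ord0 then z else args [:: u] j) = args [:: z] :> ('I_1 -> A x).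
  exact: args1E.
by rewrite !e.
Qed.

(** Cartan's formula. *)
Lemma dext1E (R : realType) (M : atlasData R) (A : bundleData M)
    (L : algebroidData A) (mu : forall x : M, ('I_1 -> A x) -> R)
    (nu : forall x : M, ('I_2 -> A x) -> R) (s0 s1 : sect A) x :
  is_dext L mu nu -> smooth_sect s0 -> smooth_sect s1 ->
  nu x (args [:: s0 x; s1 x]) =
    dfun L (fun y => mu y (args [:: s1 y])) (s0 x)
    - dfun L (fun y => mu y (args [:: s0 y])) (s1 x)
    - mu x (args [:: br L s0 s1 x]).
Proof.
move=> dx h0 h1; pose s (i : 'I_2) : sect A := if i == ord0 then s0 else s1.
have ss i : smooth_sect (s i) by rewrite /s; case: ifP.
have := dx s ss x; rewrite (@args2E _ _ (fun i => s i x) (s0 x) (s1 x)) // => ->.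
rewrite !big_ord_recl !big_ord0 /= addr0 expr0 mul1r.
have e0 : (fun y => mu y (fun p => s (lift ord0 p) y)) = fun y => mu y (args [:: s1 y]).
  by apply/funext => y; congr (mu y); apply: args1E.
have e1 : (fun y => mu y (fun p => s (lift (lift ord0 ord0) p) y)) = fun y => mu y (args [:: s0 y]).
  by apply/funext => y; congr (mu y); apply: args1E.
rewrite e0 e1 !big_mkcond !big_ord_recl !big_ord0 /= !addr0 !add0r.
rewrite /bump /= expr1 mulN1r; congr (_ + _ + _).
rewrite mulN1r [X in _ + X]big1 ?addr0 => [|[[|[|//]] h] //].
by congr (- mu x _); apply: args1E.
Qed.

(** * The differential of the contact section *)

Section ContactDifferential.
Context {R : realType} {Q : atlasData R} {E : bundleData Q}.
Hypotheses (HQ : smooth_atlas Q) (QS : separated Q) (HE : is_vbundle E).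
Variables (L : algebroid E) (LP : algebroid (prolongation L)).
Hypothesis HLP : is_prolongation LP.
Variable deta : forall x : dualR E, ('I_2 -> prolongation L x) -> R.
Hypotheses (Hdeta : is_form deta) (deta_eq : is_dext LP (contact_eta (L := L)) deta).

Local Notation k := (rank E).
Local Notation D := (dualR E).
Local Notation A := (prolongation L).
Local Notation fr := (frame (b := A)).
Local Notation eta := (@contact_eta R Q E L).
Implicit Types (ct : cidx D) (x : D).

Let HD : smooth_atlas D := dualR_atlas HQ HE.
Let DS : separated D := dualR_separated HQ QS HE.

Lemma contact_eta0 x : eta (x := x) (args [:: 0]) = 0.
Proof.
rewrite /contact_eta /args /=.
rewrite -[pr1 0]/(0 : E (dualR_pi x)) linear0 subr0.
by rewrite -[LHS]/(tfun (0 : tangent x) (fun y : D => y.2)) tfun0.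
Qed.

(** Cartan's formula for global extensions of the two frame sections; both the
    extensions and the derivatives of functions only matter near x. *)
Lemma deta_frames ct r r' x : cdom ct x ->
  local_br LP (cdom ct) (fr ct r) (fr ct r') (fun x => 0) ->
  deta (args [:: fr ct r x; fr ct r' x]) =
    pr2 (fr ct r x) (fun y => eta (args [:: fr ct r' y]))
    - pr2 (fr ct r' x) (fun y => eta (args [:: fr ct r y])).
Proof.
move=> cx br0.
have [S [U [Ss [oU Ux] Uc US]]] := extend_frame HQ QS HE r cx.
have [T [V [Ts [oV Vx] Vc VT]]] := extend_frame HQ QS HE r' cx.
have := dext1E x deta_eq Ss Ts.
rewrite (br0 (U `&` V) S T) //; first last.
- by move=> y [_ Vy]; exact: VT.
- by move=> y [Uy _]; exact: US.
- by move=> y [Uy _]; exact: Uc.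
- exact: (open_inI HD).
rewrite contact_eta0 subr0.
rewrite US // VT // => ->; rewrite /dfun !(prol_anchor HLP) -!/(pr2 _).
congr (_ - _); first by apply: (tangent_germ HD DS _ oV Vx) => y Vy; rewrite VT.
by apply: (tangent_germ HD DS _ oU Ux) => y Uy; rewrite US.
Qed.

Lemma eta_germ_V ct a x (v : tangent x) : cdom ct x ->
  v (fun y => eta (args [:: fr ct (idxV L a) y])) = 0.
Proof.
move=> cx; rewrite -[RHS](tangent_zero HD v).
apply: (tangent_germ HD DS v (@atlas_open _ _ HD ct) cx) => y cy.
by rewrite frame_idxV contact_eta_V.
Qed.

(** The function eta (X_b) is - y_b, and V_a is the derivative along y_a. *)
Lemma deta_XV ct a b x : cdom ct x ->
  deta (args [:: fr ct (idxX L b) x; fr ct (idxV L a) x]) = (a == b)%:R.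
Proof.
move=> cx; rewrite deta_frames //; last first.
  have := prol_brXV HLP (ct := ct) (a := b) (b := a).
  rewrite (_ : prolX L ct b = fr ct (idxX L b)); last by apply: functional_extensionality_dep => y; rewrite frame_idxX.
  by rewrite (_ : prolV L ct a = fr ct (idxV L a)) //; apply: functional_extensionality_dep => y; rewrite frame_idxV.
rewrite eta_germ_V // sub0r frame_idxV.
have -> : pr2 (prolV L ct a x) (fun y => eta (args [:: fr ct (idxX L b) y])) =
    pr2 (prolV L ct a x) (fun y => - coord ct (fib_idx b) y).
  apply: (tangent_germ HD DS _ (@atlas_open _ _ HD ct) cx) => y cy.
  by rewrite frame_idxX contact_eta_X.
rewrite (tangentN HD); last exact: (smooth_near_coord HD).
rewrite opprK /pr2 prolV_val //= partial_coord //.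
by rewrite (inj_eq (@lshift_inj _ _)) (inj_eq (@rshift_inj _ _)).
Qed.

Lemma deta_VV ct a b x : cdom ct x ->
  deta (args [:: fr ct (idxV L b) x; fr ct (idxV L a) x]) = 0.
Proof.
move=> cx; rewrite deta_frames ?eta_germ_V ?subr0 //.
have := prol_brVV HLP (ct := ct) (a := b) (b := a).
rewrite (_ : prolV L ct b = fr ct (idxV L b)); last by apply: functional_extensionality_dep => y; rewrite frame_idxV.
by rewrite (_ : prolV L ct a = fr ct (idxV L a)) //; apply: functional_extensionality_dep => y; rewrite frame_idxV.
Qed.

Lemma deta_VsV ct a x : cdom ct x ->
  deta (args [:: fr ct (idxVs L) x; fr ct (idxV L a) x]) = 0.
Proof.
move=> cx; rewrite (form2_anti Hdeta) deta_frames //.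
  rewrite eta_germ_V // subr0 -oppr0; congr (- _).
  rewrite -[RHS](tangent_one HD (pr2 (fr ct (idxV L a) x))).
  apply: (tangent_germ HD DS _ (@atlas_open _ _ HD ct) cx) => y cy.
  by rewrite frame_idxVs contact_eta_Vs.
have := prol_brVVs HLP (ct := ct) (a := a).
rewrite (_ : prolV L ct a = fr ct (idxV L a)); last by apply: functional_extensionality_dep => y; rewrite frame_idxV.
by rewrite (_ : prolVs L ct = fr ct (idxVs L)) //; apply: functional_extensionality_dep => y; rewrite frame_idxVs.
Qed.

Lemma pr1_frames ct x (c : 'I_(rank A) -> R) : cdom ct x ->
  pr1 (\sum_r c r *: fr ct r x) = \sum_a c (idxX L a) *: frame ct.2 a (dualR_pi x).
Proof.
move=> cx; rewrite pr1_sum sum_frames [X in _ + X + _]big1 ?addr0 => [|a _]; last first.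
  by rewrite frame_idxV /pr1 prolV_val // scaler0.
rewrite frame_idxVs [pr1 (prolVs _ _ _)]/pr1 prolVs_val // scaler0 addr0.
by apply: eq_bigr => a _; rewrite frame_idxX /pr1 prolX_val.
Qed.

Lemma pr1_frame_coef ct x (c d : 'I_k -> R) : cdom ct x ->
  \sum_a c a *: frame ct.2 a (dualR_pi x) = \sum_a d a *: frame ct.2 a (dualR_pi x) ->
  c =1 d.
Proof.
move=> [_ tx] cd a; have B := frame_basis HE tx.
have E1 := bcoord_uniq B (c := \row_a c a) (v := \sum_a c a *: frame ct.2 a (dualR_pi x)).
have E2 := bcoord_uniq B (c := \row_a d a) (v := \sum_a c a *: frame ct.2 a (dualR_pi x)).
have := E1; rewrite E2 => [/(_ _)/rowP/(_ a)|]; last first.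
  by rewrite cd; apply: eq_bigr => i _; rewrite mxE.
by rewrite !mxE => -> //; apply: eq_bigr => i _; rewrite mxE.
Qed.

(** On ker eta the form d eta pairs the vertical vectors with E through the
    evaluation of E^* on E, hence a vertical vector orthogonal to enough
    vectors over E vanishes. *)
Lemma vertical_orthogonal_eq0 ct x (c : 'I_(rank A) -> R) (w : 'I_k -> A x)
    (d : 'I_k -> 'I_(rank A) -> R) (u := \sum_r c r *: fr ct r x) :
  cdom ct x -> pr1 u = 0 -> eta (args [:: u]) = 0 ->
  (forall b, w b = \sum_r d b r *: fr ct r x) ->
  (forall b, pr1 (w b) = frame ct.2 b (dualR_pi x)) ->
  (forall b, deta (args [:: w b; u]) = 0) -> u = 0.
Proof.
move=> cx u1 eu wd w1 wu.
have cX a : c (idxX L a) = 0.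
  apply: (pr1_frame_coef (ct := ct) (c := fun a => c (idxX L a)) (d := fun=> 0) cx).
  by rewrite -pr1_frames // [LHS]u1 big1 // => i _; rewrite scale0r.
have uE : u = \sum_a c (idxV L a) *: fr ct (idxV L a) x + c (idxVs L) *: fr ct (idxVs L) x.
  rewrite /u sum_frames big1 ?add0r // => a _; by rewrite cX scale0r.
have cs : c (idxVs L) = 0.
  move: eu; rewrite /contact_eta /args /= u1 linear0 subr0 -[(prol_val u).2]/(pr2 u) uE.
  rewrite pr2D pr2Z pr2_sum addrC tfun_linear => h.
  have {}h : c (idxVs L) * pr2 (fr ct (idxVs L) x) (fun y : D => y.2) +
    tfun (\sum_a c (idxV L a) *: pr2 (fr ct (idxV L a) x)) (fun y : D => y.2) = 0 := h.
  move: h; rewrite tfun_sum (_ : (fun y : D => y.2) = coord ct (@val_idx R Q E)); last first.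
    by apply/funext => y; rewrite coord_val.
  rewrite frame_idxVs /pr2 prolVs_val // [(_, _).2]/= (partial_coord HD) // eqxx mulr1.
  rewrite big1 ?addr0 // => a _.
  by rewrite frame_idxV prolV_val // [(_, _).2]/= (partial_coord HD) // eq_lrshift mulr0.
have {}uE : u = \sum_a c (idxV L a) *: fr ct (idxV L a) x by rewrite uE cs scale0r addr0.
rewrite uE big1 // => b _; suff -> : c (idxV L b) = 0 by rewrite scale0r.
have dX a : d b (idxX L a) = (a == b)%:R.
  apply: (pr1_frame_coef (ct := ct) (c := fun a => d b (idxX L a)) (d := fun a => (a == b)%:R) cx).
  rewrite -pr1_frames // -wd w1 (bigD1 b) //= eqxx scale1r big1 ?addr0 // => i ib.
  by rewrite (negPf ib) scale0r.
have wV a : deta (args [:: w b; fr ct (idxV L a) x]) = (a == b)%:R.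
  rewrite wd (form2_suml Hdeta) sum_frames deta_VsV // mulr0 addr0.
  rewrite [X in _ + X]big1 ?addr0 => [|i _]; last by rewrite deta_VV // mulr0.
  under eq_bigr => i _ do rewrite dX deta_XV //.
  by rewrite (bigD1 b) //= eqxx mul1r big1 ?addr0 // => i ib; rewrite (negPf ib) mul0r.
rewrite -(wu b) uE (form2_sumr Hdeta); under [RHS]eq_bigr => i _ do rewrite wV.
by rewrite (bigD1 b) //= eqxx mulr1 big1 ?addr0 // => i ib; rewrite (negPf ib) mulr0.
Qed.

End ContactDifferential.

(** * The graph of a section *)

Section Graphs.
Context {R : realType} {Q : atlasData R} {E : bundleData Q}.
Hypothesis HE : is_vbundle E.
Variables (L : algebroid E) (LP : algebroid (prolongation L)).
Variable gamma : forall q : Q, {scalar E q} * R.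

Local Notation D := (dualR E).
Local Notation A := (prolongation L).
Local Notation F := (graph_bundle L gamma).
Local Notation eta := (@contact_eta R Q E L).

Hypothesis Hsub : is_subalgebroid (graph_algebroid L gamma) LP (@graph_j R Q E L gamma).

(** A frame vector of F is defined by projecting a pair to a subtype with default
    value 0; being part of a basis it is not 0, hence it is that pair. *)
Lemma graph_frame_pr1 (t : fidx E) a q : fdom t q ->
  pr1 (graph_val (frame (b := F) t a (to_graph gamma q))) = frame t a q.
Proof.
move=> tq; have B := frame_basis (sub_vbundle Hsub) (t := t) (x := to_graph gamma q) tq.
have := basis_neq0 B (i := a); rewrite /= /graph_iso.
set w := graph_lift _ _ _ => n0.
have e : graph_val (insubd 0 w : graph_fib L gamma (sect_map gamma q)) = w.
  have [wP|/negbTE wP] := boolP (w \in graph_pred (L := L) gamma (x := sect_map gamma q)).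
    exact: insubdK wP.
  have h : insubd 0 w = 0 :> graph_fib L gamma (sect_map gamma q).
    by rewrite /insubd; case: insubP => // v; rewrite wP.
  by case: n0; exact: h.
rewrite e; case: (boolP (w == 0)) => [/eqP w0|].
  by case: n0; apply: val_inj; rewrite /= e w0.
rewrite /w /graph_lift; set p := (_, _) => pn0.
have -> : pr1 (insubd 0 p : prol_fib L (sect_map gamma q)) = p.1; last by [].
have [pP|/negbTE pP] := boolP (p \in @prol_pred _ _ _ L (sect_map gamma q)).
  by rewrite /pr1; have -> : prol_val (insubd 0 p : prol_fib L (sect_map gamma q)) = p := insubdK 0 pP.
by move: pn0; rewrite /insubd; case: insubP => [v|_]; rewrite ?pP ?eqxx.
Qed.

(** Frames of F lie over frames of E, so every vector of E is the projection of
    one of F. In particular T gamma (rho a) is a genuine tangent vector for every a. *)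
Lemma graph_lift_onto q (v : E q) :
  exists2 w : graph_fib L gamma (sect_map gamma q),
    pr1 (graph_val w) = v & graph_lift L gamma (x := sect_map gamma q) v = graph_val w.
Proof.
have [t tq] := frames_cover HE q; have B := frame_basis HE tq.
pose w : graph_fib L gamma (sect_map gamma q) :=
  \sum_a bcoord B v ord0 a *: frame (b := F) t a (to_graph gamma q).
have w1 : pr1 (graph_val w) = v.
  rewrite [RHS](bcoordK B) /w.
  have -> : graph_val (\sum_a bcoord B v ord0 a *: frame (b := F) t a (to_graph gamma q)) =
     \sum_a bcoord B v ord0 a *: graph_val (frame (b := F) t a (to_graph gamma q)).
    by elim/big_rec2: _ => // i u1 u2 _ <-.
  by rewrite pr1_sum; apply: eq_bigr => a _; rewrite graph_frame_pr1.
exists w => //; rewrite /graph_lift.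
have /asboolP := graph_valP w; rewrite w1 => <-.
have -> : insubd 0 (tfun (prol_val (graph_val w)).2) = (prol_val (graph_val w)).2 := valKd 0 _.
rewrite -{1}w1 /pr1 -surjective_pairing; exact: valKd.
Qed.

Hypothesis Heta : forall (x : graph_base gamma) (a : F x), eta (x := graph_i x) (args [:: graph_j a]) = 0.
Hypothesis eta_form : is_form eta.
Variable deta : forall x : D, ('I_2 -> A x) -> R.
Hypotheses (Hdeta : is_form deta) (deta_eq : is_dext LP eta deta).

(** The pull-back of the contact section to the graph vanishes, hence so does
    that of its differential. *)
Lemma graph_isotropic q (u w : graph_fib L gamma (sect_map gamma q)) :
  deta (args [:: graph_val u; graph_val w]) = 0.
Proof.
have HN := manifold_atlas (sub_manifold Hsub); have HF := sub_vbundle Hsub.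
have NS : separated (graph_base gamma) by case: (sub_manifold Hsub).
pose y := to_graph gamma q.
have [t ty] := frames_cover HF y; have B := frame_basis HF ty.
have ext (v : F y) : exists2 s : sect F, smooth_sect s & s y = v.
  have [||s [V [ss [_ Vy] _ Ve]]] := @extend_sect _ _ HN NS F t
    (fun a _ => bcoord B v ord0 a) y (@frame_open _ _ _ HF) (frame_compatible HF) => //.
    by move=> a; apply: (smooth_on_cst HN); exact: (frame_open HF).
  by exists s => //; rewrite Ve // -(bcoordK B).
have [S Ss Sy] := ext u; have [T Ts Ty] := ext w.
have [_ dpull] := sub_morphism Hsub.
have dx := dpull 1%N eta deta eta_form Hdeta deta_eq.
have := dext1E y dx Ss Ts.
have eta0 (s : sect F) : (fun z : graph_base gamma =>
    eta (x := graph_i z) (fun p => graph_j (args [:: s z] p))) = fun=> 0.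
  apply/funext => z; rewrite -[RHS](Heta (s z)); congr (eta _).
  exact: args1E.
rewrite !eta0 /dfun !(tangent_zero HN) subr0 sub0r Sy Ty.
set b := br _ _ _ _.
rewrite (_ : eta _ = 0) ?oppr0; last by rewrite -[RHS](Heta b); congr (eta _); exact: args1E.
move=> <-; congr (deta _); apply/esym; exact: args2E.
Qed.

End Graphs.

Theorem theorem7p4 (R : realType)
  (Q : atlasData R) (HQ : is_manifold Q)
  (E : bundleData Q) (HE : is_vbundle E) (L : algebroid E)
  (LP : algebroid (prolongation L)) (HLP : is_prolongation LP)
  (deta : forall x : dualR E, ('I_2 -> prolongation L x) -> R)
  (Hdeta : is_form deta) (deta_eq : is_dext LP (contact_eta (L := L)) deta)
  (reeb : sect (prolongation L))
  (Hreeb : is_reeb (contact_eta (L := L)) deta reeb)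
  (H : dualR E -> R) (HH : smooth_fun H)
  (xi : sect (prolongation L))
  (Hxi : is_hamiltonian LP (contact_eta (L := L)) deta reeb H xi)
  (gamma : forall q : Q, {scalar E q} * R)
  (Hgamma : smooth_map (sect_map gamma))
  (Hleg : is_legendrian (graph_algebroid L gamma) LP
            (@graph_j R Q E L gamma) (rank E) (contact_eta (L := L))) :
  let Ev := evolution_sect H reeb xi in
  let Ev_gamma : sect E := fun q => pr1 (Ev (sect_map gamma q)) in
  (forall q : Q, Ev (sect_map gamma q) =
     graph_lift L gamma (x := sect_map gamma q) (Ev_gamma q))
  <->
  (forall (q : Q) (a : E q), dfun L (H \o sect_map gamma) a = 0).
Proof.
move=> Ev Ev_gamma.
have HA := manifold_atlas HQ; have QS : separated Q by case: HQ.
have HD := dualR_atlas HA HE.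
have Hsub := legendrian_sub Hleg.
have eta_form := contact_form (legendrian_contact Hleg).
have eta0 := legendrian_eta Hleg.
have iso q := @graph_isotropic _ _ _ _ _ _ Hsub eta0 eta_form _ Hdeta deta_eq q.
have onto q := @graph_lift_onto _ _ _ HE _ _ _ Hsub q.
have [xis xi_eta xi_deta] := Hxi; have [rs r_deta r_eta] := Hreeb.
have EvE q : Ev (sect_map gamma q) =
    H (sect_map gamma q) *: reeb (sect_map gamma q) + xi (sect_map gamma q).
  by rewrite /Ev /evolution_sect addrC.
(* on the graph, d eta (Ev, -) is the differential of H along gamma *)
have key q (w : graph_fib L gamma (sect_map gamma q)) :
    deta _ (args [:: Ev (sect_map gamma q); graph_val w]) =
    dfun L (H \o sect_map gamma) (pr1 (graph_val w)).
  rewrite EvE (form2ZDl Hdeta) r_deta mulr0 add0r xi_deta.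
  rewrite (eta0 (to_graph gamma q) w) mulr0 subr0.
  rewrite /dfun (prol_anchor HLP); have /asboolP -> := graph_valP w.
  by rewrite /push asboolT //; exact: (smooth_nearT HD).
split=> [Evrel q a|dH q].
  have [w <- _] := onto q a; have [w0 _ e0] := onto q (Ev_gamma q).
  by rewrite -key Evrel e0; exact: iso.
have [w0 w01 ->] := onto q (Ev_gamma q); set x := sect_map gamma q.
have [ct cx] := atlas_cover HD x.
have [xc [_ xiE]] := xis ct; have [rc [_ rE]] := rs ct.
(* smoothness of xi, of the Reeb section and of the inclusion of F puts all the
   vectors involved in the span of the local frame at x *)
have gs (w : graph_fib L gamma x) : exists c : 'I_(rank (prolongation L)) -> R,
    graph_val w = \sum_r c r *: frame (b := prolongation L) ct r x.
  have [t tq] := frames_cover (sub_vbundle Hsub) (to_graph gamma q).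
  have B := frame_basis (sub_vbundle Hsub) tq.
  have [[_ _ jsm] _] := sub_morphism Hsub.
  have js a : exists g : 'I_(rank (prolongation L)) -> R,
      graph_val (frame t a (to_graph gamma q)) =
      \sum_r g r *: frame (b := prolongation L) ct r x.
    by have [g [_ ge]] := jsm t ct a; exists (fun r => g r (to_graph gamma q)); exact: (ge _ tq cx).
  pose g a := sval (cid (js a)).
  have ge a : graph_val (frame t a (to_graph gamma q)) =
      \sum_r g a r *: frame (b := prolongation L) ct r x by exact: (svalP (cid (js a))).
  exists (fun r => \sum_a bcoord B w ord0 a * g a r).
  under eq_bigr do rewrite scaler_suml.
  rewrite exchange_big /= {1}(bcoordK B w).
  have -> : graph_val (\sum_a bcoord B w ord0 a *: frame t a (to_graph gamma q)) =
     \sum_a bcoord B w ord0 a *: graph_val (frame t a (to_graph gamma q)).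
    by elim/big_rec2: _ => // i u1 u2 _ <-.
  apply: eq_bigr => a _; rewrite ge scaler_sumr.
  by apply: eq_bigr => r _; rewrite scalerA.
have [c0 c0E] := gs w0.
have uE : -1 *: graph_val w0 + Ev x =
    \sum_r (- c0 r + (H x * rc r x + xc r x)) *: frame (b := prolongation L) ct r x.
  rewrite EvE rE // xiE // c0E !scaler_sumr -!big_split; apply: eq_bigr => r _ /=.
  by rewrite !scalerDl !scalerA mulN1r.
have wb b : exists2 w : graph_fib L gamma x,
    pr1 (graph_val w) = frame ct.2 b q & deta x (args [:: graph_val w;
      -1 *: graph_val w0 + Ev x]) = 0.
  have [w w1 _] := onto q (frame ct.2 b q); exists w => //.
  by rewrite (form2_anti Hdeta) (form2ZDl Hdeta) iso mulr0 add0r key dH oppr0.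
pose w b := s2val (cid2 (wb b)); pose d b := sval (cid (gs (w b))).
suff u0 : -1 *: graph_val w0 + Ev x = 0.
  by move: u0; rewrite scaleN1r addrC => /subr0_eq.
rewrite uE; apply: (@vertical_orthogonal_eq0 _ _ _ HA QS HE L LP HLP deta Hdeta deta_eq
  ct x _ (fun b => graph_val (w b)) d cx).
- by rewrite -uE pr1ZD w01 scaleN1r addNr.
- rewrite -uE (form1ZD _ _ _ eta_form) (eta0 (to_graph gamma q) w0) mulr0 add0r EvE.
  by rewrite (form1ZD _ _ _ eta_form) r_eta xi_eta mulr1 subrr.
- by move=> b; exact: (svalP (cid (gs (w b)))).
- by move=> b; exact: (s2valP (cid2 (wb b))).
- by move=> b; rewrite -uE; exact: (s2valP' (cid2 (wb b))).
Qed.
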